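(* Let $k$ be an algebraically closed field of arbitrary characteristic, let $H$ be a finite-dimensional cosemisimple unimodular Hopf algebra over $k$, and let $L,J$ be twists for $H$. Then $H^{(L,J)}$ is a cosemisimple coalgebra.
   Context: Let $\Delta,\varepsilon$ be the comultiplication and counit of $H$. A twist for $H$ is an invertible $J\in H\otimes H$ with $(\Delta\otimes\mathrm{id})(J)(J\otimes 1)=(\mathrm{id}\otimes\Delta)(J)(1\otimes J)$, normalized by $(\varepsilon\otimes\mathrm{id})(J)=(\mathrm{id}\otimes\varepsilon)(J)=1$. For twists $L,J$ for $H$, $H^{(L,J)}$ denotes the coalgebra with underlying vector space $H$, comultiplication $\tilde\Delta(h)=L^{-1}\Delta(h)J$ and counit $\varepsilon$. $H$ is unimodular if the left and right integrals in $H$ coincide. *)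

(* Defs.v *)
From HB Require Import structures.
From mathcomp Require Import all_boot all_order all_algebra all_field.

Set Implicit Arguments.
Unset Strict Implicit.
Unset Printing Implicit Defensive.

Import GRing.Theory.
Local Open Scope ring_scope.

Reserved Notation "u *t v" (at level 40, left associativity).

(* A tensor in U (x) V is stored as its coefficient matrix in the basis
   e_i (x) e_j, where e_i runs over vbasis fullv; tens_lift, tens_liftE and
   tens_ind below are the universal property. *)
Definition tens (k : fieldType) (U V : vectType k) : Type :=
  'M[k]_(\dim {:U}, \dim {:V}).

HB.instance Definition _ (k : fieldType) (U V : vectType k) :=
  Vector.copy (tens U V) 'M[k]_(\dim {:U}, \dim {:V}).

Definition pure (k : fieldType) (U V : vectType k) (u : U) (v : V) : tens U V :=
  \matrix_(i, j) (coord (vbasis {:U}) i u * coord (vbasis {:V}) j v).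

Notation "u *t v" := (pure u v) : ring_scope.

(* The linear map sending u *t v to f u v; meaningful for bilinear f. *)
Definition tens_lift (k : fieldType) (U V W : vectType k) (f : U -> V -> W)
    (t : tens U V) : W :=
  \sum_(i < \dim {:U}) \sum_(j < \dim {:V})
    (t : 'M_(_, _)) i j *: f (vbasis {:U})`_i (vbasis {:V})`_j.

Section Tensor.
Variable k : fieldType.
Implicit Types U V W X Y : vectType k.

Lemma tens_lift_is_linear U V W (f : U -> V -> W) : linear (tens_lift f).
Proof.
move=> a s t; rewrite /tens_lift scaler_sumr -big_split; apply: eq_bigr => i _.
rewrite scaler_sumr -big_split; apply: eq_bigr => j _.
by rewrite /= !mxE scalerDl scalerA.
Qed.

HB.instance Definition _ U V W (f : U -> V -> W) :=
  GRing.isLinear.Build k (tens U V) W _ (tens_lift f) (tens_lift_is_linear f).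

Lemma pureDl U V (u u' : U) (v : V) : (u + u') *t v = u *t v + u' *t v.
Proof. by apply/matrixP => i j; rewrite !mxE linearD mulrDl. Qed.

Lemma pureDr U V (u : U) (v v' : V) : u *t (v + v') = u *t v + u *t v'.
Proof. by apply/matrixP => i j; rewrite !mxE linearD mulrDr. Qed.

Lemma pureZl U V a (u : U) (v : V) : (a *: u) *t v = a *: (u *t v).
Proof. by apply/matrixP => i j; rewrite !mxE linearZ /= mulrA. Qed.

Lemma pureZr U V a (u : U) (v : V) : u *t (a *: v) = a *: (u *t v).
Proof. by apply/matrixP => i j; rewrite !mxE linearZ /= mulrCA. Qed.

Lemma pure0l U V (v : V) : (0 : U) *t v = 0.
Proof. by rewrite -(scale0r (0 : U)) pureZl scale0r. Qed.

Lemma tens_liftE U V W (f : U -> V -> W) (u : U) (v : V) :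
  (forall y, linear (f^~ y)) -> (forall x, linear (f x)) ->
  tens_lift f (u *t v) = f u v.
Proof.
move=> fl fr.
pose fL y : {linear U -> W} :=
  HB.pack (f^~ y) (GRing.isLinear.Build k U W _ _ (fl y)).
pose fR x : {linear V -> W} :=
  HB.pack (f x) (GRing.isLinear.Build k V W _ _ (fr x)).
rewrite -[RHS]/(fL v u) {2}(coord_vbasis (memvf u)) linear_sum.
apply: eq_bigr => i _; rewrite linearZ /= -[f _ v]/(fR _ v).
rewrite {2}(coord_vbasis (memvf v)) linear_sum scaler_sumr.
by apply: eq_bigr => j _; rewrite linearZ /= scalerA mxE.
Qed.

Lemma coord_vbasisE U (i i' : 'I_(\dim {:U})) :
  coord (vbasis {:U}) i (vbasis {:U})`_i' = (i == i')%:R.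
Proof. by rewrite coord_free 1?eq_sym //; apply: basis_free (vbasisP _). Qed.

Lemma tens_basis U V (t : tens U V) :
  t = \sum_(i < \dim {:U}) \sum_(j < \dim {:V})
        (t : 'M_(_, _)) i j *: ((vbasis {:U})`_i *t (vbasis {:V})`_j).
Proof.
apply/matrixP => i j; rewrite summxE (bigD1 i) //= summxE (bigD1 j) //=.
rewrite !mxE !coord_vbasisE !eqxx !mulr1 !big1 ?addr0 // => [i' ni|j' nj].
  rewrite summxE big1 // => j' _.
  by rewrite !mxE coord_vbasisE eq_sym (negPf ni) mul0r mulr0.
by rewrite !mxE !coord_vbasisE (eq_sym j) (negPf nj) !mulr0.
Qed.

Lemma tens_ind U V (P : tens U V -> Prop) :
  (forall u v, P (u *t v)) -> (forall s t, P s -> P t -> P (s + t)) ->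
  forall t, P t.
Proof.
move=> Pp PD t; have P0 : P 0 by rewrite -(pure0l U (0 : V)).
rewrite [t]tens_basis; apply: (big_ind P) => // i _.
by apply: (big_ind P) => // j _; rewrite -pureZl.
Qed.

Definition tens_map U V X Y (f : 'Hom(U, X)) (g : 'Hom(V, Y)) :
    'Hom(tens U V, tens X Y) :=
  linfun (tens_lift (fun u v => f u *t g v)).

Lemma tens_mapE U V X Y (f : 'Hom(U, X)) (g : 'Hom(V, Y)) u v :
  tens_map f g (u *t v) = f u *t g v.
Proof.
rewrite lfunE /= tens_liftE // => x a y z; rewrite linearP.
  by rewrite pureDl pureZl.
by rewrite pureDr pureZr.
Qed.

Definition tens_assoc U V W : 'Hom(tens (tens U V) W, tens U (tens V W)) :=
  linfun (tens_lift (fun s w => tens_lift (fun u v => u *t (v *t w)) s)).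

Lemma tens_assocE U V W (u : U) (v : V) (w : W) :
  tens_assoc U V W ((u *t v) *t w) = u *t (v *t w).
Proof.
have pE x y z : tens_lift (fun (u : U) (v : V) => u *t (v *t (z : W))) (x *t y)
    = x *t (y *t z).
  rewrite tens_liftE // => x' a y' z'.
    by rewrite pureDl pureZl.
  by rewrite pureDl pureZl pureDr pureZr.
rewrite lfunE /= tens_liftE // => s a y z; first exact: linearP.
elim/tens_ind: s => [u' v'|s t IHs IHt].
  by rewrite !pE !pureDr !pureZr.
by rewrite !linearD /= IHs IHt addrACA.
Qed.

Definition tens_unitl V : 'Hom(tens k^o V, V) :=
  linfun (tens_lift (fun (c : k^o) (v : V) => (c : k) *: v)).

Lemma tens_unitlE V (c : k^o) (v : V) : tens_unitl V (c *t v) = (c : k) *: v.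
Proof.
rewrite lfunE /= tens_liftE // => [y a c1 c2|c1 a x y].
  by rewrite scalerDl scalerA.
by rewrite scalerDr !scalerA mulrC.
Qed.

Definition tens_unitr U : 'Hom(tens U k^o, U) :=
  linfun (tens_lift (fun (u : U) (c : k^o) => (c : k) *: u)).

Lemma tens_unitrE U (u : U) (c : k^o) : tens_unitr U (u *t c) = (c : k) *: u.
Proof.
rewrite lfunE /= tens_liftE // => [c1 a x y|y a c1 c2].
  by rewrite scalerDr !scalerA mulrC.
by rewrite scalerDl scalerA.
Qed.

Definition tensv U V (D : {vspace U}) (E : {vspace V}) : {vspace tens U V} :=
  <<[seq u *t v | u <- vbasis D, v <- vbasis E]>>%VS.

Lemma memv_tensv U V (D : {vspace U}) (E : {vspace V}) u v :
  u \in D -> v \in E -> u *t v \in tensv D E.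
Proof.
move=> uD vE; rewrite (coord_vbasis uD) (coord_vbasis vE).
elim/big_ind: _ => [|x y hx hy|i _]; first by rewrite pure0l mem0v.
  by rewrite pureDl memvD.
rewrite pureZl memvZ //; elim/big_ind: _ => [|x y hx hy|j _].
- by rewrite -(scale0r (0 : V)) pureZr scale0r mem0v.
- by rewrite pureDr memvD.
rewrite pureZr memvZ // memv_span //.
by apply: allpairs_f; rewrite mem_nth ?size_tuple.
Qed.

End Tensor.

Section TensorAlgebra.
Variables (k : fieldType) (A B : falgType k).

(* Componentwise product: (a *t b) (c *t d) = (a c) *t (b d). *)
Definition tens_mul (s t : tens A B) : tens A B :=
  tens_lift (fun a b => tens_lift (fun c d => (a * c) *t (b * d)) t) s.

Lemma tens_mul_linl t : linear (tens_mul^~ t).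
Proof. by move=> a s s'; rewrite /tens_mul linearP. Qed.

Lemma tens_mul_linr s : linear (tens_mul s).
Proof.
move=> a t t'; rewrite /tens_mul.
pose g x y := tens_lift (fun c d => (x * c : A) *t (y * d : B)).
have gP x y : linear (g x y) by exact: linearP.
change (tens_lift (fun x y => g x y (a *: t + t')) s
        = a *: tens_lift (fun x y => g x y t) s
          + tens_lift (fun x y => g x y t') s).
rewrite /tens_lift.
move: g gP => g gP; rewrite scaler_sumr -big_split; apply: eq_bigr => i _.
rewrite scaler_sumr -big_split; apply: eq_bigr => j _.
by rewrite gP scalerDr !scalerA mulrC.
Qed.

Lemma tens_mulE a b c d : tens_mul (a *t b) (c *t d) = (a * c) *t (b * d).
Proof.
have E x y z w : tens_lift (fun c d => (x * c) *t (y * d)) (z *t w)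
    = (x * z : A) *t (y * w : B).
  by rewrite tens_liftE // => ? e ? ?;
     rewrite mulrDr -scalerAr ?pureDl ?pureZl ?pureDr ?pureZr.
rewrite /tens_mul tens_liftE ?E // => x e y z; rewrite !E.
  by rewrite mulrDl -scalerAl pureDl pureZl.
by rewrite mulrDl -scalerAl pureDr pureZr.
Qed.

Lemma tens_mulDl : left_distributive tens_mul +%R.
Proof. by move=> s s' t; have := tens_mul_linl t 1 s s'; rewrite !scale1r. Qed.

Lemma tens_mulDr : right_distributive tens_mul +%R.
Proof. by move=> s t t'; have := tens_mul_linr s 1 t t'; rewrite !scale1r. Qed.

Lemma tens_mulA : associative tens_mul.
Proof.
move=> s t r; elim/tens_ind: s => [a b|s s' IH IH']; last first.
  by rewrite !tens_mulDl IH IH'.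
elim/tens_ind: t => [c d|t t' IH IH']; last first.
  by rewrite !(tens_mulDl, tens_mulDr) IH IH'.
elim/tens_ind: r => [e f|r r' IH IH']; last first.
  by rewrite !tens_mulDr IH IH'.
by rewrite !tens_mulE !mulrA.
Qed.

Lemma tens_mul1l : left_id (1 *t 1) tens_mul.
Proof.
move=> t; elim/tens_ind: t => [c d|t t' IH IH'].
  by rewrite tens_mulE !mul1r.
by rewrite tens_mulDr IH IH'.
Qed.

Lemma tens_mul1r : right_id (1 *t 1) tens_mul.
Proof.
move=> t; elim/tens_ind: t => [c d|t t' IH IH'].
  by rewrite tens_mulE !mulr1.
by rewrite tens_mulDl IH IH'.
Qed.

Lemma pure_neq0 (U V : vectType k) (u : U) (v : V) :
  u != 0 -> v != 0 -> u *t v != 0.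
Proof.
move=> u0 v0.
have ex (W : vectType k) (w : W) :
    w != 0 -> exists i, coord (vbasis {:W}) i w != 0.
  move=> w0; apply/existsP; rewrite -negb_forall; apply: contra w0.
  move=> /forallP w0; rewrite (coord_vbasis (memvf w)) big1 // => i _.
  by rewrite (eqP (w0 i)) scale0r.
have [i ui] := ex _ _ u0; have [j vj] := ex _ _ v0.
apply/eqP => /matrixP/(_ i j); rewrite !mxE => /eqP.
by rewrite mulf_eq0 (negPf ui) (negPf vj).
Qed.

Lemma tens_1_neq0 : (1 : A) *t (1 : B) != 0.
Proof. by rewrite pure_neq0 ?oner_neq0. Qed.

Lemma tens_mul0l t : tens_mul 0 t = 0.
Proof. by rewrite /tens_mul linear0. Qed.

Lemma tens_mul0r s : tens_mul s 0 = 0.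
Proof.
by have := tens_mul_linr s (-1) 0 0; rewrite scaler0 addr0 scaleN1r addNr.
Qed.

Lemma tens_mulZl (a : k) s t : a *: tens_mul s t = tens_mul (a *: s) t.
Proof. by have := tens_mul_linl t a s 0; rewrite tens_mul0l !addr0. Qed.

Lemma tens_mulZr (a : k) s t : a *: tens_mul s t = tens_mul s (a *: t).
Proof. by have := tens_mul_linr s a t 0; rewrite tens_mul0r !addr0. Qed.

HB.instance Definition _ := GRing.Zmodule_isNzRing.Build (tens A B)
  tens_mulA tens_mul1l tens_mul1r tens_mulDl tens_mulDr tens_1_neq0.

HB.instance Definition _ :=
  GRing.Lmodule_isLalgebra.Build k (tens A B) tens_mulZl.
HB.instance Definition _ :=
  GRing.Lalgebra_isAlgebra.Build k (tens A B) tens_mulZr.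
HB.instance Definition _ := Algebra_isFalgebra.Build k (tens A B).

Lemma pureM (a c : A) (b d : B) : (a *t b) * (c *t d) = (a * c) *t (b * d).
Proof. exact: tens_mulE. Qed.

Lemma pure1 : (1 : A) *t (1 : B) = 1. Proof. by []. Qed.

End TensorAlgebra.

Section TensorMorphisms.
Variable k : fieldType.
Implicit Types A B C D : falgType k.

Lemma tens_mapM A B C D (f : 'Hom(A, C)) (g : 'Hom(B, D)) :
  (forall x y, f (x * y) = f x * f y) -> (forall x y, g (x * y) = g x * g y) ->
  forall s t : tens A B, tens_map f g (s * t) = tens_map f g s * tens_map f g t.
Proof.
move=> fM gM s t; elim/tens_ind: s => [a b|s s' IH IH']; last first.
  by rewrite mulrDl !linearD /= mulrDl IH IH'.
elim/tens_ind: t => [c d|t t' IH IH']; last first.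
  by rewrite mulrDr !linearD /= mulrDr IH IH'.
by rewrite pureM !tens_mapE pureM fM gM.
Qed.

Lemma tens_assocM A B C (s t : tens (tens A B) C) :
  tens_assoc A B C (s * t) = tens_assoc A B C s * tens_assoc A B C t.
Proof.
elim/tens_ind: s => [x c|s s' IH IH']; last first.
  by rewrite mulrDl !linearD /= mulrDl IH IH'.
elim/tens_ind: x => [a b|x x' IH IH']; last first.
  by rewrite pureDl mulrDl !linearD /= mulrDl IH IH'.
elim/tens_ind: t => [y c'|t t' IH IH']; last first.
  by rewrite mulrDr !linearD /= mulrDr IH IH'.
elim/tens_ind: y => [a' b'|y y' IH IH']; last first.
  by rewrite pureDl mulrDr !linearD /= mulrDr IH IH'.
by rewrite !pureM !tens_assocE !pureM.
Qed.

Lemma tens_unitlM A (s t : tens k^o A) :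
  tens_unitl A (s * t) = tens_unitl A s * tens_unitl A t.
Proof.
elim/tens_ind: s => [c a|s s' IH IH']; last first.
  by rewrite mulrDl !linearD /= mulrDl IH IH'.
elim/tens_ind: t => [d b|t t' IH IH']; last first.
  by rewrite mulrDr !linearD /= mulrDr IH IH'.
by rewrite pureM !tens_unitlE -scalerAl -scalerAr scalerA.
Qed.

Lemma tens_unitrM A (s t : tens A k^o) :
  tens_unitr A (s * t) = tens_unitr A s * tens_unitr A t.
Proof.
elim/tens_ind: s => [a c|s s' IH IH']; last first.
  by rewrite mulrDl !linearD /= mulrDl IH IH'.
elim/tens_ind: t => [b d|t t' IH IH']; last first.
  by rewrite mulrDr !linearD /= mulrDr IH IH'.
by rewrite pureM !tens_unitrE -scalerAl -scalerAr scalerA.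
Qed.

End TensorMorphisms.

Record coalgebra (k : fieldType) (C : vectType k) := Coalgebra {
  comul : 'Hom(C, tens C C);
  counit : 'Hom(C, k^o);
  comulA : forall c,
    tens_assoc C C C (tens_map comul \1%VF (comul c)) =
    tens_map \1%VF comul (comul c);
  counitl : forall c, tens_unitl C (tens_map counit \1%VF (comul c)) = c;
  counitr : forall c, tens_unitr C (tens_map \1%VF counit (comul c)) = c
}.

Record hopf_algebra (k : fieldType) (H : falgType k) := HopfAlgebra {
  hopf_coalgebra :> coalgebra H;
  antipode : 'End(H);
  comul1 : comul hopf_coalgebra 1 = 1;
  comulM : forall x y,
    comul hopf_coalgebra (x * y) =
    comul hopf_coalgebra x * comul hopf_coalgebra y;
  counit1 : counit hopf_coalgebra 1 = 1;
  counitM : forall x y,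
    counit hopf_coalgebra (x * y) =
    counit hopf_coalgebra x * counit hopf_coalgebra y;
  antipodel : forall x,
    tens_lift *%R (tens_map antipode \1%VF (comul hopf_coalgebra x)) =
    (counit hopf_coalgebra x : k)%:A;
  antipoder : forall x,
    tens_lift *%R (tens_map \1%VF antipode (comul hopf_coalgebra x)) =
    (counit hopf_coalgebra x : k)%:A
}.

Section Coalgebras.
Variables (k : fieldType) (C : vectType k) (A : coalgebra C).

Definition subcoalgebra (D : {vspace C}) : Prop :=
  (comul A @: D <= tensv D D)%VS.

Definition simple_subcoalgebra (D : {vspace C}) : Prop :=
  [/\ D != 0%VS, subcoalgebra D
    & forall E : {vspace C},
        subcoalgebra E -> (E <= D)%VS -> E = 0%VS \/ E = D].

(* C is finite-dimensional, so a direct decomposition has finitely many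
   summands. *)
Definition cosemisimple : Prop :=
  exists (n : nat) (D : 'I_n -> {vspace C}),
    [/\ forall i, simple_subcoalgebra (D i),
        directv (\sum_i D i) & (\sum_i D i)%VS = fullv].

End Coalgebras.

Section Hopf.
Variables (k : fieldType) (H : falgType k) (A : hopf_algebra H).
Local Notation Delta := (comul A).
Local Notation eps := (counit A).

Definition left_integral (x : H) : Prop :=
  forall h, h * x = (eps h : k) *: x.

Definition right_integral (x : H) : Prop :=
  forall h, x * h = (eps h : k) *: x.

Definition unimodular : Prop :=
  forall x, left_integral x <-> right_integral x.

Definition twist (J : tens H H) : Prop :=
  [/\ J \is a GRing.unit,
      tens_assoc H H H (tens_map Delta \1%VF J * (J *t 1)) =
        tens_map \1%VF Delta J * (1 *t J),
      tens_unitl H (tens_map eps \1%VF J) = 1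
    & tens_unitr H (tens_map \1%VF eps J) = 1].

Definition twisted_comul (L J : tens H H) : 'Hom(H, tens H H) :=
  (amulr J \o (amull L^-1%R \o Delta))%VF.

Lemma twisted_comulE L J h : twisted_comul L J h = L^-1 * Delta h * J.
Proof. by rewrite !(comp_lfunE, lfunE). Qed.

Lemma tens_map_twistedl L J s :
  tens_map (twisted_comul L J) \1%VF s =
  (L^-1 *t (1 : H)) * tens_map Delta \1%VF s * (J *t 1).
Proof.
elim/tens_ind: s => [a b|s s' IH IH'].
  by rewrite !tens_mapE twisted_comulE !pureM !lfunE /= mul1r mulr1.
by rewrite !linearD /= mulrDr mulrDl IH IH'.
Qed.

Lemma tens_map_twistedr L J s :
  tens_map \1%VF (twisted_comul L J) s =
  ((1 : H) *t L^-1) * tens_map \1%VF Delta s * (1 *t J).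
Proof.
elim/tens_ind: s => [a b|s s' IH IH'].
  by rewrite !tens_mapE twisted_comulE !pureM !lfunE /= mul1r mulr1.
by rewrite !linearD /= mulrDr mulrDl IH IH'.
Qed.

Let idM (x y : H) : (\1%VF : 'End(H)) (x * y) = \1%VF x * \1%VF y.
Proof. by rewrite !id_lfunE. Qed.

Let DlM := tens_mapM (comulM A) idM.
Let DrM := tens_mapM idM (comulM A).

Let Dl1 : tens_map Delta \1%VF (1 : tens H H) = 1.
Proof. by rewrite -[X in tens_map _ _ X]pure1 tens_mapE comul1 id_lfunE. Qed.

Let Dr1 : tens_map \1%VF Delta (1 : tens H H) = 1.
Proof. by rewrite -[X in tens_map _ _ X]pure1 tens_mapE comul1 id_lfunE. Qed.

Let assoc1 : tens_assoc H H H 1 = 1.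
Proof.
by rewrite -[X in tens_assoc _ _ _ X]pure1 -[X in X *t _]pure1 tens_assocE.
Qed.

Lemma twisted_comulA L J (hL : twist L) (hJ : twist J) h :
  tens_assoc H H H
    (tens_map (twisted_comul L J) \1%VF (twisted_comul L J h)) =
  tens_map \1%VF (twisted_comul L J) (twisted_comul L J h).
Proof.
have [uL eL _ _] := hL; have [_ eJ _ _] := hJ.
rewrite tens_map_twistedl tens_map_twistedr twisted_comulE !DlM !DrM.
have -> : forall a b c d e : tens (tens H H) H,
    a * (b * c * d) * e = a * b * c * (d * e) by move=> *; rewrite !mulrA.
have -> : forall a b c d e : tens H (tens H H),
    a * (b * c * d) * e = a * b * c * (d * e) by move=> *; rewrite !mulrA.
rewrite 2!tens_assocM eJ comulA; congr (_ * _ * _).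
set X := LHS; set Y := RHS.
have XK : X * tens_assoc H H H (tens_map Delta \1%VF L * (L *t 1)) = 1.
  rewrite /X -tens_assocM mulrA -(mulrA (_ *t _)) -DlM mulVr // Dl1 mulr1.
  by rewrite pureM mulVr // mul1r pure1 assoc1.
have YK : tens_map \1%VF Delta L * (1 *t L) * Y = 1.
  rewrite /Y mulrA -(mulrA (tens_map _ _ _)) pureM mulrV // mul1r pure1 mulr1.
  by rewrite -DrM mulrV // Dr1.
by rewrite -[LHS]mulr1 -YK -eL mulrA XK mul1r.
Qed.

Let unitlM (s t : tens H H) :
  tens_unitl H (tens_map eps \1%VF (s * t)) =
  tens_unitl H (tens_map eps \1%VF s) * tens_unitl H (tens_map eps \1%VF t).
Proof. by rewrite (tens_mapM (counitM A) idM) tens_unitlM. Qed.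

Let unitrM (s t : tens H H) :
  tens_unitr H (tens_map \1%VF eps (s * t)) =
  tens_unitr H (tens_map \1%VF eps s) * tens_unitr H (tens_map \1%VF eps t).
Proof. by rewrite (tens_mapM idM (counitM A)) tens_unitrM. Qed.

Lemma twisted_counitl L J (hL : twist L) (hJ : twist J) h :
  tens_unitl H (tens_map eps \1%VF (twisted_comul L J h)) = h.
Proof.
have [uL _ eL _] := hL; have [_ _ eJ _] := hJ.
rewrite twisted_comulE !unitlM counitl eJ mulr1.
suff -> : tens_unitl H (tens_map eps \1%VF L^-1) = 1 by rewrite mul1r.
rewrite -[LHS]mulr1 -eL -unitlM mulVr // -[X in tens_map _ _ X]pure1.
by rewrite tens_mapE tens_unitlE counit1 id_lfunE scale1r.
Qed.

Lemma twisted_counitr L J (hL : twist L) (hJ : twist J) h :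
  tens_unitr H (tens_map \1%VF eps (twisted_comul L J h)) = h.
Proof.
have [uL _ _ eL] := hL; have [_ _ _ eJ] := hJ.
rewrite twisted_comulE !unitrM counitr eJ mulr1.
suff -> : tens_unitr H (tens_map \1%VF eps L^-1) = 1 by rewrite mul1r.
rewrite -[LHS]mulr1 -eL -unitrM mulVr // -[X in tens_map _ _ X]pure1.
by rewrite tens_mapE tens_unitrE counit1 id_lfunE scale1r.
Qed.

(* The coalgebra H^(L,J). *)
Definition twisted_coalgebra L J (hL : twist L) (hJ : twist J) : coalgebra H :=
  Coalgebra (twisted_comulA hL hJ)
    (twisted_counitl hL hJ) (twisted_counitr hL hJ).

End Hopf.

(* Main.v *)
From HB Require Import structures.
Require Import Defs.
From mathcomp Require Import all_boot all_order all_algebra all_field.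
From mathcomp Require Import zify.
From Stdlib Require Import Classical.

Set Implicit Arguments.
Unset Strict Implicit.
Unset Printing Implicit Defensive.

Import GRing.Theory.
Local Open Scope ring_scope.

(** A finite-dimensional coalgebra C is cosemisimple as soon as it is
coseparable, that is, as soon as it carries a bilinear form B with
B(c_1, c_2) = eps(c) and c_1 B(c_2, d) = B(c, d_1) d_2: averaging a linear
projection onto a subcoalgebra D against B gives a bicolinear one, whose
complementary projection cuts out a complement of D
([subcoalgebra_projection], [subcoalgebra_complement]); induction on the
dimension then yields the decomposition ([coseparable_cosemisimple]).

So it suffices to write down such a form for the twisted coalgebra.  Since H
is cosemisimple, 1 spans one of its simple summands, and the projection onto
it is an integral lam in the dual of H with lam(1) = 1
([cosemisimple_integral]).  For trivial twists the form is lam(c S(d)).  For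
twists L, J let Q_J = S(J^1) J^2, which is invertible with inverse
P_J = K^1 S(K^2), where K = J^-1; the form is

  B(c, d) = lam(c P_J S(d) S(Q_L)).

Two facts make it work.  The cocycle identity determines Delta(Q_J)
([comul_twist_elt]), and this lets P_J absorb J and Q_L absorb L^-1 when lam is
moved across a coproduct ([twist_invariance_sw],
[twist_inv_invariance_sw]).  To bring L^-1 and J to the proper places inside
lam one also needs lam(x y) = lam(y S^2(x)) ([nakayama]); this is where
unimodularity enters.  Indeed (x, y) |-> lam(x y) is nondegenerate, so there
is t with lam(t y) = eps(y); this t is a right integral, hence by
unimodularity also a left one, and computing the antipode from t in two ways
gives both the injectivity of S and the rule for lam(x y).  With that rule, in
B(c_1, c_2) for the twisted coproduct the elements P_J and Q_L get surrounded
by the legs of J and of L^-1 and cancel: J^1 P_J S(J^2) = 1 and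
S(M^1) Q_L M^2 = 1 for M = L^-1 ([twist_conj_inv_sw], [twist_conj_sw]). *)

(** * Linear maps and Sweedler sums *)

(** A Sweedler sum: [\sw_(a, b <- Delta c) E a b] is E(c_1, c_2), and for a
twist J the sum [\sw_(a, b <- J) E a b] is E(J^1, J^2).  It has its expected
value only for bilinear E, so that almost every rewriting rule below asks for
linearity in each slot. *)
Notation "\sw_ ( a , b <- t ) E" := (tens_lift (fun a b => E) t)
  (at level 41, a name, b name, t at level 50, E at level 41,
   format "\sw_ ( a ,  b  <-  t )  E") : ring_scope.

Section Lin.
Variable k : fieldType.
Implicit Types (U V W : lmodType k) (R : algType k).

(** Linearity as a property of unbundled functions, so that it can be proved by
recursion on the shape of a Sweedler expression. *)
Definition islin U V (f : U -> V) :=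
  forall a x y, f (a *: x + y) = a *: f x + f y.

Lemma islin_id U : islin (fun x : U => x). Proof. by []. Qed.

Lemma islin_mull U R (f : U -> R) c : islin f -> islin (fun x => f x * c).
Proof. by move=> fl a x y; rewrite fl mulrDl scalerAl. Qed.

Lemma islin_mulr U R (f : U -> R) c : islin f -> islin (fun x => c * f x).
Proof. by move=> fl a x y; rewrite fl mulrDr scalerAr. Qed.

Lemma islin_scalel U V (f : U -> k^o) (c : V) :
  islin f -> islin (fun x => (f x : k) *: c).
Proof. by move=> fl a x y; rewrite fl scalerDl scalerA. Qed.

Lemma islin_scaler U V (f : U -> V) (c : k) : islin f -> islin (fun x => c *: f x).
Proof. by move=> fl a x y; rewrite fl scalerDr !scalerA mulrC. Qed.

Lemma islin_add U V (f g : U -> V) : islin f -> islin g -> islin (fun x => f x + g x).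
Proof. by move=> fl gl a x y; rewrite fl gl scalerDr addrACA. Qed.

Lemma islin_opp U V (f : U -> V) : islin f -> islin (fun x => - f x).
Proof. by move=> fl a x y; rewrite fl opprD scalerN. Qed.

Lemma islin0 U V (f : U -> V) : islin f -> f 0 = 0.
Proof. by move=> fl; have := fl (-1) 0 0; rewrite !scaleN1r !addNr. Qed.

Lemma islinZ U V (f : U -> V) a x : islin f -> f (a *: x) = a *: f x.
Proof. by move=> fl; rewrite -[a *: x]addr0 fl islin0 // addr0. Qed.

Lemma islinD U V (f : U -> V) x y : islin f -> f (x + y) = f x + f y.
Proof. by move=> fl; rewrite -[x in LHS]scale1r fl scale1r. Qed.

End Lin.

Section LinTens.
Variable k : fieldType.
Implicit Types U V W X : vectType k.

Lemma islin_hom (X : lmodType k) U V (A : 'Hom(U, V)) (f : X -> U) :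
  islin f -> islin (fun x => A (f x)).
Proof. by move=> fl a x y; rewrite fl linearP. Qed.

Lemma islin_purel (X : lmodType k) U V (f : X -> U) (v : V) :
  islin f -> islin (fun x => f x *t v).
Proof. by move=> fl a x y; rewrite fl pureDl pureZl. Qed.

Lemma islin_purer (X : lmodType k) U V (f : X -> V) (u : U) :
  islin f -> islin (fun x => u *t f x).
Proof. by move=> fl a x y; rewrite fl pureDr pureZr. Qed.

Lemma islin_sw_arg (X : lmodType k) U V W (f : U -> V -> W) (t : X -> tens U V) :
  islin t -> islin (fun x => tens_lift f (t x)).
Proof. by move=> tl a x y; rewrite tl linearP. Qed.

Lemma islin_sw (X : lmodType k) U V W (f : X -> U -> V -> W) (t : tens U V) :
  (forall u v, islin (fun x => f x u v)) -> islin (fun x => tens_lift (f x) t).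
Proof.
move=> fl a x y; rewrite /tens_lift scaler_sumr -big_split; apply: eq_bigr => i _.
rewrite scaler_sumr -big_split; apply: eq_bigr => j _.
by rewrite fl scalerDr !scalerA mulrC.
Qed.

Lemma islin_linfun U V (f : U -> V) : islin f -> forall x, linfun f x = f x.
Proof.
move=> fl x.
pose g : {linear U -> V} := HB.pack f (GRing.isLinear.Build k U V _ _ fl).
exact: (lfunE g).
Qed.

Lemma tens_ext U V W (F G : tens U V -> W) : islin F -> islin G ->
  (forall u v, F (u *t v) = G (u *t v)) -> forall t, F t = G t.
Proof.
move=> Fl Gl FG; apply: tens_ind => // s t Hs Ht.
by have := (Fl 1 s t, Gl 1 s t); rewrite !scale1r => -[-> ->]; rewrite Hs Ht.
Qed.

End LinTens.

(** Proves that an expression is linear in its bound variable, by following the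
one argument in which that variable occurs. *)
Ltac lin :=
  intros; cbv beta;
  lazymatch goal with
  | |- @islin ?k ?U ?V ?f =>
      (* undo eta-contraction, which would hide the bound variable *)
      change (@islin k U V (fun x => f x)); cbv beta
  end;
  lazymatch goal with
  | |- islin (fun x => x) => exact (@islin_id _ _)
  | |- islin (fun x => _ * _) => first [apply islin_mull | apply islin_mulr]; lin
  | |- islin (fun x => _ *: _) => first [apply islin_scalel | apply islin_scaler]; lin
  | |- islin (fun x => _ + _) => apply islin_add; lin
  | |- islin (fun x => - _) => apply islin_opp; lin
  | |- islin (fun x => _ *t _) => first [apply islin_purel | apply islin_purer]; lin
  | |- islin (fun x => @tens_lift ?k ?U ?V ?W _ _) =>
      first [apply (@islin_sw k _ U V W) | apply (@islin_sw_arg k _ U V W)]; lin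
  | |- islin (fun x => fun_of_lfun ?A _) => apply (islin_hom A); lin
  | |- _ => solve [auto | match goal with H : _ |- _ => exact H || apply H end]
  end.

Section Sw.
Variable k : fieldType.
Implicit Types U V W X : vectType k.

Lemma sw_pure U V W (f : U -> V -> W) u v :
  (forall y, islin (fun x => f x y)) -> (forall x, islin (f x)) ->
  \sw_(a, b <- u *t v) f a b = f u v.
Proof. exact: tens_liftE. Qed.

Lemma eq_sw U V W (f g : U -> V -> W) t : (forall u v, f u v = g u v) ->
  \sw_(a, b <- t) f a b = \sw_(a, b <- t) g a b.
Proof.
by move=> fg; apply: eq_bigr => i _; apply: eq_bigr => j _; rewrite fg.
Qed.

(** A Sweedler sum is by definition a linear combination of values of f. *)
Lemma sw_map U V W X (F : W -> X) (f : U -> V -> W) t : islin F ->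
  F (\sw_(a, b <- t) f a b) = \sw_(a, b <- t) F (f a b).
Proof.
move=> Fl; pose g : {linear W -> X} := HB.pack F (GRing.isLinear.Build k W X _ _ Fl).
rewrite -[F]/(g : W -> X) linear_sum; apply: eq_bigr => i _.
by rewrite linear_sum; apply: eq_bigr => j _; rewrite linearZ.
Qed.

Lemma exchange_sw U V U' V' W (f : U -> V -> U' -> V' -> W) s t :
  \sw_(a, b <- s) \sw_(c, d <- t) f a b c d =
  \sw_(c, d <- t) \sw_(a, b <- s) f a b c d.
Proof.
have E (U1 V1 : vectType k) (W1 : vectType k) (g : U1 -> V1 -> W1) r : tens_lift g r =
    \sum_p (r : 'M_(_, _)) p.1 p.2 *: g (vbasis {:U1})`_p.1 (vbasis {:V1})`_p.2.
  by rewrite /tens_lift pair_bigA.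
rewrite !E; under eq_bigr do rewrite E scaler_sumr.
rewrite exchange_big; apply: eq_bigr => q _; rewrite E scaler_sumr.
by apply: eq_bigr => p _; rewrite !scalerA mulrC.
Qed.

Lemma sw_id U V (t : tens U V) : \sw_(a, b <- t) (a *t b) = t.
Proof. by rewrite [RHS]tens_basis. Qed.

End Sw.

Section SwCoalgebra.
Variables (k : fieldType) (C W : vectType k) (A : coalgebra C).
Local Notation Delta := (comul A).
Local Notation eps := (counit A).

(** Coassociativity as it is used in Sweedler calculus: both sides are
f(x_1, x_2, x_3). *)
Lemma coassoc_sw (f : C -> C -> C -> W) x :
  (forall b c, islin (fun a => f a b c)) -> (forall a c, islin (fun b => f a b c)) ->
  (forall a b, islin (fun c => f a b c)) ->
  \sw_(a, b <- Delta x) \sw_(c, d <- Delta a) f c d b =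
  \sw_(a, b <- Delta x) \sw_(c, d <- Delta b) f a c d.
Proof.
move=> f1 f2 f3.
pose G (t : tens C (tens C C)) := \sw_(a, r <- t) \sw_(c, d <- r) f a c d.
have GP a r : G (a *t r) = \sw_(c, d <- r) f a c d by rewrite /G sw_pure //; lin.
transitivity (G (tens_map \1%VF Delta (Delta x))).
  rewrite -comulA; move: (Delta x); apply: tens_ext; [lin|rewrite /G; lin|move=> u v].
  rewrite sw_pure; try lin; rewrite tens_mapE id_lfunE.
  move: (Delta u); apply: tens_ext; [lin|rewrite /G; lin|move=> a b].
  by rewrite sw_pure; try lin; rewrite tens_assocE GP sw_pure //; lin.
move: (Delta x); apply: tens_ext; [rewrite /G;lin|lin|move=> u v].
by rewrite tens_mapE id_lfunE GP sw_pure //; lin.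
Qed.

Lemma counitl_sw (f : C -> W) x : islin f ->
  \sw_(a, b <- Delta x) ((eps a : k) *: f b) = f x.
Proof.
move=> fl; rewrite -[in RHS](counitl A x).
have -> : tens_unitl C (tens_map eps \1%VF (Delta x)) =
    \sw_(a, b <- Delta x) ((eps a : k) *: b).
  move: (Delta x); apply: tens_ext; [lin|lin|move=> u v].
  by rewrite tens_mapE tens_unitlE id_lfunE sw_pure //; lin.
by rewrite (sw_map _ _ fl); apply: eq_sw => a b; rewrite islinZ.
Qed.

Lemma counitr_sw (f : C -> W) x : islin f ->
  \sw_(a, b <- Delta x) ((eps b : k) *: f a) = f x.
Proof.
move=> fl; rewrite -[in RHS](counitr A x).
have -> : tens_unitr C (tens_map \1%VF eps (Delta x)) =
    \sw_(a, b <- Delta x) ((eps b : k) *: a).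
  move: (Delta x); apply: tens_ext; [lin|lin|move=> u v].
  by rewrite tens_mapE tens_unitrE id_lfunE sw_pure //; lin.
by rewrite (sw_map _ _ fl); apply: eq_sw => a b; rewrite islinZ.
Qed.

End SwCoalgebra.

Section SwAlgebra.
Variables (k : fieldType) (A B : falgType k) (W : vectType k).

Lemma mul_sw (f : A -> B -> W) s t :
  (forall b, islin (fun a => f a b)) -> (forall a, islin (f a)) ->
  \sw_(a, b <- s * t) f a b =
  \sw_(a, b <- s) \sw_(c, d <- t) f (a * c) (b * d).
Proof.
move=> f1 f2.
have f1M c d : islin (fun a => f (a * c) d)
  by move=> e x y; rewrite mulrDl -scalerAl; apply: f1.
have f2M c d : islin (fun b => f d (b * c))
  by move=> e x y; rewrite mulrDl -scalerAl; apply: f2.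
have f1N c d : islin (fun a => f (c * a) d)
  by move=> e x y; rewrite mulrDr -scalerAr; apply: f1.
have f2N c d : islin (fun b => f d (c * b))
  by move=> e x y; rewrite mulrDr -scalerAr; apply: f2.
move: s; apply: tens_ext; [lin|lin|move=> a b].
move: t; apply: tens_ext; [lin|lin|move=> c d].
by rewrite pureM; do !(rewrite sw_pure; try lin).
Qed.

End SwAlgebra.

Section SwHopf.
Variables (k : fieldType) (H : falgType k) (A : hopf_algebra H).
Local Notation Delta := (comul A).
Local Notation eps := (counit A).
Local Notation S := (antipode A).

Lemma antipodel_sw (W : vectType k) (f : H -> W) x : islin f ->
  \sw_(a, b <- Delta x) f (S a * b) = (eps x : k) *: f 1.
Proof.
move=> fl; rewrite -islinZ // -antipodel.
rewrite -[tens_lift *%R _]/(\sw_(a, b <- _) (a * b))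
        -(sw_map _ _ fl); congr (f _).
move: (Delta x); apply: tens_ext; [lin|lin|move=> u v].
by rewrite tens_mapE id_lfunE; do !(rewrite sw_pure; try lin).
Qed.

Lemma antipoder_sw (W : vectType k) (f : H -> W) x : islin f ->
  \sw_(a, b <- Delta x) f (a * S b) = (eps x : k) *: f 1.
Proof.
move=> fl; rewrite -islinZ // -antipoder.
rewrite -[tens_lift *%R _]/(\sw_(a, b <- _) (a * b))
        -(sw_map _ _ fl); congr (f _).
move: (Delta x); apply: tens_ext; [lin|lin|move=> u v].
by rewrite tens_mapE id_lfunE; do !(rewrite sw_pure; try lin).
Qed.

Lemma antipode1 : S 1 = 1.
Proof.
have := @antipodel_sw _ (fun x => x) 1 (@islin_id _ _).
by rewrite comul1 -pure1 sw_pure; try lin; rewrite counit1 mulr1 scale1r.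
Qed.

End SwHopf.

Section AntipodeMorphism.
Variables (k : fieldType) (H : falgType k) (A : hopf_algebra H).
Local Notation Delta := (comul A).
Local Notation eps := (counit A).
Local Notation S := (antipode A).

(** Both sides are convolution inverses of the multiplication H (x) H -> H: the
sum of S(x_1 y_1) x_2 y_2 S(y_3) S(x_3) collapses to either of them. *)
Lemma antipodeM x y : S (x * y) = S y * S x.
Proof.
have E1 u v z : \sw_(a, b <- Delta u) \sw_(c, d <- Delta v)
    (S (a * c) * (b * d) * z) = (eps u : k) *: ((eps v : k) *: z).
  rewrite -(mul_sw (f := fun a b => S a * b * z)); try lin.
  rewrite -comulM (antipodel_sw A (f := fun w => w * z)); try lin.
  by rewrite counitM mul1r scalerA.
have E2 u v z : \sw_(a, b <- Delta u) \sw_(c, d <- Delta v)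
    (z * (a * c) * (S d * S b)) = (eps u : k) *: ((eps v : k) *: z).
  transitivity (\sw_(a, b <- Delta u) ((eps v : k) *: (z * a * S b))).
    apply: eq_sw => a b.
    transitivity (\sw_(c, d <- Delta v) (z * a * (c * S d) * S b)).
      by apply: eq_sw => c d; rewrite !mulrA.
    by rewrite (antipoder_sw A (f := fun w => z * a * w * S b)) ?mulr1 //; lin.
  transitivity (\sw_(a, b <- Delta u) ((eps v : k) *: (z * (a * S b)))).
    by apply: eq_sw => a b; rewrite !mulrA.
  by rewrite (antipoder_sw A (f := fun w => (eps v : k) *: (z * w))) ?mulr1 //; lin.
transitivity (\sw_(a, b <- Delta x) \sw_(c, d <- Delta y)
    \sw_(a1, a2 <- Delta a) \sw_(c1, c2 <- Delta c)
    (S (a1 * c1) * (a2 * c2) * (S d * S b))); last first.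
  under eq_sw => a b do under eq_sw => c d do rewrite E1.
  under eq_sw => a b.
    rewrite -(sw_map (F := fun z => (eps a : k) *: z)); try lin.
    rewrite (counitl_sw A (f := fun z => S z * S b)); try lin.
    over.
  by rewrite (counitl_sw A (f := fun z => S y * S z)); try lin.
under eq_sw => a b do rewrite exchange_sw.
under eq_sw => a b do under eq_sw => a1 a2 do
  (rewrite (coassoc_sw A (f := fun c1 c2 d =>
     S (a1 * c1) * (a2 * c2) * (S d * S b))); try lin).
rewrite (coassoc_sw A (f := fun a1 a2 b =>
  \sw_(c, d <- Delta y) \sw_(c1, d1 <- Delta d)
  (S (a1 * c) * (a2 * c1) * (S d1 * S b)))); try lin.
under eq_sw => a b do rewrite exchange_sw.
under eq_sw => a b do under eq_sw => c d do rewrite E2.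
under eq_sw => a b.
  rewrite -(sw_map (F := fun z => (eps b : k) *: z)); try lin.
  rewrite (counitr_sw A (f := fun z => S (a * z))); try lin.
  over.
by rewrite (counitr_sw A (f := fun z => S (z * y))); try lin.
Qed.

(** The antipode of the Hopf algebra H (x) H followed by the flip; being
anti-multiplicative, it is what turns Delta(x) into Delta(S(x)). *)
Definition antipode_flip : 'End(tens H H) :=
  linfun (fun t => \sw_(a, b <- t) (S b *t S a)).
Local Notation sigma := antipode_flip.

Lemma antipode_flip_sw t : sigma t = \sw_(a, b <- t) (S b *t S a).
Proof. by rewrite /sigma islin_linfun //; lin. Qed.

Lemma antipode_flipE a b : sigma (a *t b) = S b *t S a.
Proof. by rewrite antipode_flip_sw sw_pure //; lin. Qed.

Lemma antipode_flipM s t : sigma (s * t) = sigma t * sigma s.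
Proof.
move: s; apply: tens_ext; [lin|lin|move=> a b].
move: t; apply: tens_ext; [lin|lin|move=> c d].
by rewrite pureM !antipode_flipE pureM !antipodeM.
Qed.

Lemma antipode_flip1 : sigma 1 = 1.
Proof. by rewrite -pure1 antipode_flipE antipode1. Qed.

Lemma comul_flip_sw x :
  \sw_(a, b <- Delta x) (Delta a * sigma (Delta b)) = (eps x : k) *: 1.
Proof.
transitivity (\sw_(a, b <- Delta x) \sw_(c, d <- Delta a)
    ((c *t d) * sigma (Delta b))).
  apply: eq_sw => a b; rewrite -[Delta a in LHS]sw_id.
  by rewrite (sw_map (F := fun z => z * sigma (Delta b))) //; lin.
rewrite (coassoc_sw A (f := fun c d b => (c *t d) * sigma (Delta b))); try lin.
transitivity (\sw_(a, b <- Delta x) (a * S b *t (1 : H))); last first.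
  by rewrite (antipoder_sw A (f := fun z => z *t (1 : H))) //; lin.
apply: eq_sw => a b.
transitivity (\sw_(c, d <- Delta b) \sw_(u, v <- Delta d) (a * S v *t (c * S u))).
  apply: eq_sw => c d; rewrite antipode_flip_sw.
  rewrite (sw_map (F := fun z => (a *t c) * z)); try lin.
  by apply: eq_sw => u v; rewrite pureM.
rewrite -(coassoc_sw A (f := fun c u v => a * S v *t (c * S u))); try lin.
under eq_sw => c d.
  rewrite (antipoder_sw A (f := fun z => a * S d *t z)); try lin.
  over.
by rewrite (counitl_sw A (f := fun z => a * S z *t (1 : H))) //; lin.
Qed.

(** Both sides are convolution inverses of Delta : H -> H (x) H. *)
Lemma comul_antipode x : Delta (S x) = sigma (Delta x).
Proof.
transitivity (\sw_(a, b <- Delta x) \sw_(c, d <- Delta a)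
    (Delta (S c) * Delta d * sigma (Delta b))).
  rewrite (coassoc_sw A (f := fun c d b => Delta (S c) * Delta d * sigma (Delta b)));
    try lin.
  under eq_sw => a b.
    under eq_sw => c d do rewrite -mulrA.
    rewrite -(sw_map (F := fun z => Delta (S a) * z)) ?comul_flip_sw; try lin.
    rewrite -scalerAr mulr1.
    over.
  by rewrite (counitr_sw A (f := fun z => Delta (S z))) //; lin.
under eq_sw => a b.
  under eq_sw => c d do rewrite -comulM.
  rewrite (antipodel_sw A (f := fun z => Delta z * sigma (Delta b))); try lin.
  rewrite comul1 mul1r.
  over.
by rewrite (counitl_sw A (f := fun z => sigma (Delta z))) //; lin.
Qed.
End AntipodeMorphism.

(** * The element attached to a twist *)

(** Left multiplication by y is injective, hence onto by finite dimension. *)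
Lemma falg_mulr1C (k : fieldType) (R : falgType k) (x y : R) :
  x * y = 1 -> y * x = 1.
Proof.
move=> xy1; have ker0 : lker (amull y) == 0%VS.
  apply/lker0P => u v; rewrite !lfunE /= => h; have := congr1 ( *%R x) h.
  by rewrite !mulrA xy1 !mul1r.
have : 1 \in limg (amull y) by rewrite lker0_limgf // memvf.
case/memv_imgP => w _; rewrite lfunE /= => y1.
have -> : x = w by rewrite -[LHS]mulr1 y1 mulrA xy1 mul1r.
by rewrite -y1.
Qed.

Section Twist.
Variables (k : fieldType) (H : falgType k) (A : hopf_algebra H).
Local Notation Delta := (comul A).
Local Notation eps := (counit A).
Local Notation S := (antipode A).
Local Notation sigma := (antipode_flip A).

Lemma tens_unitl_sw (t : tens H H) :
  tens_unitl H (tens_map eps \1%VF t) = \sw_(a, b <- t) ((eps a : k) *: b).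
Proof.
move: t; apply: tens_ext; [lin|lin|move=> u v].
by rewrite tens_mapE tens_unitlE id_lfunE sw_pure //; lin.
Qed.

Lemma tens_unitr_sw (t : tens H H) :
  tens_unitr H (tens_map \1%VF eps t) = \sw_(a, b <- t) ((eps b : k) *: a).
Proof.
move: t; apply: tens_ext; [lin|lin|move=> u v].
by rewrite tens_mapE tens_unitrE id_lfunE sw_pure //; lin.
Qed.

Lemma antipodel_comul_sw u (r : tens H H) :
  \sw_(a, b <- Delta u * r) (S a * b) = (eps u : k) *: \sw_(a, b <- r) (S a * b).
Proof.
move: r; apply: tens_ext; [lin|lin|move=> c d].
rewrite mul_sw; try lin; rewrite sw_pure; try lin.
under eq_sw => a b.
  rewrite sw_pure; try lin; rewrite (antipodeM A) -mulrA (mulrA (S a)).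
  over.
by rewrite (antipodel_sw A (f := fun z => S c * (z * d))) ?mul1r //; lin.
Qed.

Lemma antipoder_comul_sw u (r : tens H H) :
  \sw_(a, b <- r * Delta u) (a * S b) = (eps u : k) *: \sw_(a, b <- r) (a * S b).
Proof.
move: r; apply: tens_ext; [lin|lin|move=> c d].
rewrite mul_sw; try lin; rewrite !sw_pure; try lin.
under eq_sw => a b.
  rewrite (antipodeM A) -mulrA (mulrA a).
  over.
by rewrite (antipoder_sw A (f := fun z => c * (z * S d))) ?mul1r //; lin.
Qed.

(** The element Q_J = S(J^1) J^2: conjugation by it relates S to the antipode of
the Hopf algebra H with comultiplication J^-1 Delta J. *)
Definition twist_elt (J : tens H H) : H := \sw_(a, b <- J) (S a * b).
Definition twist_elt_inv (J : tens H H) : H := \sw_(a, b <- J^-1) (a * S b).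

(** The cocycle identity of J, to which x (x) y (x) z |-> S(x) y (x) z has been
applied: on its left-hand side the coproduct of J^1 collapses. *)
Lemma twist_elt_comul_sw J : twist A J ->
  \sw_(u, v <- J) ((S u *t 1) * Delta v) = (twist_elt J *t 1) * J^-1.
Proof.
case=> uJ coc nl _.
pose G (t : tens H (tens H H)) := \sw_(x, r <- t) ((S x *t (1 : H)) * r).
have GM s : G (s * (1 *t J)) = G s * J.
  move: s; apply: tens_ext; [rewrite /G; lin|rewrite /G; lin|move=> x r].
  by rewrite /G pureM mulr1 !sw_pure ?mulrA //; lin.
have GD t : G (tens_map \1%VF Delta t) = \sw_(u, v <- t) ((S u *t 1) * Delta v).
  move: t; apply: tens_ext; [rewrite /G; lin|lin|move=> x r].
  by rewrite /G tens_mapE id_lfunE !sw_pure //; lin.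
have GA x z : G (tens_assoc H H H (x *t z)) = (\sw_(a, b <- x) (S a * b)) *t z.
  move: x; apply: tens_ext; [rewrite /G; lin|lin|move=> a b].
  by rewrite tens_assocE /G !sw_pure; try lin; rewrite pureM mul1r.
have GL t : G (tens_assoc H H H (tens_map Delta \1%VF t * (J *t 1))) =
    \sw_(u, v <- t) ((eps u : k) *: (twist_elt J *t v)).
  move: t; apply: tens_ext; [rewrite /G; lin|lin|move=> u v].
  rewrite tens_mapE id_lfunE pureM mulr1 GA antipodel_comul_sw sw_pure; try lin.
  by rewrite pureZl.
apply: (mulIr uJ); rewrite mulrVK // -GD -GM -coc GL.
under eq_sw => u v do rewrite -pureZr.
rewrite -(sw_map (F := fun z => twist_elt J *t z)); try lin.
by rewrite -tens_unitl_sw nl.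
Qed.

(** The previous identity, to which x (x) y |-> x S(y) has been applied. *)
Lemma twist_eltK J : twist A J -> twist_elt J * twist_elt_inv J = 1.
Proof.
move=> hJ; have [uJ _ _ nr] := hJ.
rewrite /twist_elt_inv.
rewrite (sw_map (F := fun z => twist_elt J * z)); try lin.
transitivity (\sw_(a, b <- (twist_elt J *t 1) * J^-1) (a * S b)).
  rewrite mul_sw; try lin; rewrite sw_pure; try lin.
  by apply: eq_sw => a b; rewrite mul1r mulrA.
rewrite -twist_elt_comul_sw //.
rewrite (sw_map (F := fun t => \sw_(a, b <- t) (a * S b))); try lin.
under eq_sw => u v.
  rewrite antipoder_comul_sw sw_pure; try lin.
  rewrite antipode1 mulr1.
  over.
transitivity (S (\sw_(u, v <- J) ((eps v : k) *: u))).
  rewrite (sw_map (F := S)); try lin; apply: eq_sw => u v.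
  by rewrite linearZ.
by rewrite -tens_unitr_sw nr antipode1.
Qed.

Lemma twist_elt_invK J : twist A J -> twist_elt_inv J * twist_elt J = 1.
Proof. by move=> hJ; apply: falg_mulr1C (twist_eltK hJ). Qed.

(** How far Q_J is from being grouplike.  This is the cocycle identity of J, to
which (x (x) y) (x) z |-> (S(y) (x) S(x)) Delta(z) has been applied; the sum on
its other side is again that of [twist_elt_comul_sw]. *)
Lemma comul_twist_elt J : twist A J ->
  sigma J * Delta (twist_elt J) = (twist_elt J *t twist_elt J) * J^-1.
Proof.
move=> hJ; have [uJ coc nl _] := hJ.
pose G (t : tens H (tens H H)) :=
  \sw_(x, r <- t) \sw_(y, z <- r) ((S y *t S x) * Delta z).
have GA s z : G (tens_assoc H H H (s *t z)) = sigma s * Delta z.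
  move: s; apply: tens_ext; [rewrite /G; lin|lin|move=> x y].
  by rewrite tens_assocE /G !sw_pure ?antipode_flipE //; lin.
have GL t : G (tens_assoc H H H (tens_map Delta \1%VF t * (J *t 1))) =
    \sw_(u, v <- t) (sigma J * (Delta (S u) * Delta v)).
  move: t; apply: tens_ext; [rewrite /G; lin|lin|move=> u v].
  rewrite tens_mapE id_lfunE pureM mulr1 GA antipode_flipM sw_pure; try lin.
  by rewrite comul_antipode mulrA.
have GD u r v : G (u *t (Delta v * r)) =
    (1 *t (S u * v)) * \sw_(c, d <- r) ((S c *t 1) * Delta d).
  move: r; apply: tens_ext; [rewrite /G; lin|lin|move=> c d].
  rewrite [in RHS]sw_pure; try lin.
  rewrite /G sw_pure; try lin; rewrite mul_sw; try lin.
  transitivity (\sw_(a, b <- Delta v)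
     (((S c *t S u) * ((S a *t 1) * Delta b)) * Delta d)).
    apply: eq_sw => a b; rewrite sw_pure; try lin.
    by rewrite antipodeM comulM !mulrA pureM mulr1.
  transitivity (\sw_(a, b <- Delta v) \sw_(b1, b2 <- Delta b)
     (((S c *t S u) * ((S a *t 1) * (b1 *t b2))) * Delta d)).
    apply: eq_sw => a b; rewrite -[Delta b in LHS]sw_id.
    by rewrite (sw_map (F := fun z =>
      (((S c *t S u) * ((S a *t 1) * z)) * Delta d))) //; lin.
  rewrite -(coassoc_sw A (f := fun a b1 b2 =>
    (((S c *t S u) * ((S a *t 1) * (b1 *t b2))) * Delta d))); try lin.
  under eq_sw => a b.
    under eq_sw => a1 a2 do rewrite pureM mul1r.
    rewrite (antipodel_sw A (f := fun z =>
      (((S c *t S u) * (z *t b)) * Delta d))); try lin.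
    over.
  rewrite (counitl_sw A (f := fun z =>
    (((S c *t S u) * (1 *t z)) * Delta d))); try lin.
  by rewrite mulrA !pureM !mulr1 !mul1r.
have GR t : G (tens_map \1%VF Delta t * (1 *t J)) =
    \sw_(u, v <- t) ((1 *t (S u * v)) * ((twist_elt J *t 1) * J^-1)).
  move: t; apply: tens_ext; [rewrite /G; lin|lin|move=> u v].
  rewrite tens_mapE id_lfunE pureM mulr1 GD twist_elt_comul_sw //.
  by rewrite sw_pure //; lin.
transitivity (\sw_(u, v <- J) (sigma J * (Delta (S u) * Delta v))).
  rewrite -(sw_map (F := fun z => sigma J * z)); try lin; congr (_ * _).
  under eq_sw => u v do rewrite -comulM.
  by rewrite -(sw_map (F := fun z => Delta z)) //; lin.
rewrite -GL coc GR -(sw_map (F := fun z => z * ((twist_elt J *t 1) * J^-1))); try lin.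
rewrite -(sw_map (F := fun z => (1 : H) *t z)); try lin.
by rewrite mulrA pureM mulr1 mul1r.
Qed.

Lemma twist_inv_comul J : twist A J ->
  J^-1 * Delta (twist_elt_inv J) = (twist_elt_inv J *t twist_elt_inv J) * sigma J.
Proof.
move=> hJ; have <- : sigma J * Delta (twist_elt J) * Delta (twist_elt_inv J) = sigma J.
  by rewrite -mulrA -comulM twist_eltK // comul1 mulr1.
by rewrite comul_twist_elt // !mulrA pureM twist_elt_invK // pure1 mul1r.
Qed.

(** The P_J in the coseparability form absorbs J: this is the contribution of J
to the invariance of the form. *)
Lemma twist_invariance_sw J : twist A J ->
  \sw_(u, v <- J) ((S u *t 1) * Delta v * Delta (twist_elt_inv J)) =
  (1 *t twist_elt_inv J) * sigma J.
Proof.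
move=> hJ; rewrite -(sw_map (F := fun z => z * Delta (twist_elt_inv J))); try lin.
rewrite twist_elt_comul_sw // -mulrA twist_inv_comul // mulrA pureM twist_eltK //.
by rewrite mul1r.
Qed.

Lemma twist_inv_cocycle J : twist A J ->
  tens_assoc H H H ((J^-1 *t 1) * tens_map Delta \1%VF J^-1) =
  (1 *t J^-1) * tens_map \1%VF Delta J^-1.
Proof.
case=> uJ coc _ _.
have idM (x y : H) : (\1%VF : 'End(H)) (x * y) = \1%VF x * \1%VF y.
  by rewrite !id_lfunE.
have DlM := tens_mapM (comulM A) idM; have DrM := tens_mapM idM (comulM A).
set X := LHS; set Y := RHS.
have XK : X * tens_assoc H H H (tens_map Delta \1%VF J * (J *t 1)) = 1.
  rewrite /X -tens_assocM mulrA -(mulrA (_ *t _)) -DlM mulVr //.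
  rewrite -[X in tens_map _ _ X]pure1 tens_mapE comul1 id_lfunE pure1 mulr1.
  by rewrite pureM mulVr // mul1r -pure1 tens_assocE.
have YK : tens_map \1%VF Delta J * (1 *t J) * Y = 1.
  rewrite /Y mulrA -(mulrA (tens_map _ _ _)) pureM mulrV // mul1r pure1 mulr1.
  rewrite -DrM mulrV // -[X in tens_map _ _ X]pure1.
  by rewrite tens_mapE comul1 id_lfunE pure1.
by rewrite -[LHS]mulr1 -YK -coc mulrA XK mul1r.
Qed.

Lemma twist_inv_counitl_sw J : twist A J ->
  \sw_(a, b <- J^-1) ((eps a : k) *: b) = 1.
Proof.
case=> uJ _ nl _; rewrite -tens_unitl_sw.
have idM (x y : H) : (\1%VF : 'End(H)) (x * y) = \1%VF x * \1%VF y.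
  by rewrite !id_lfunE.
rewrite -[LHS]mulr1 -[in LHS]nl -tens_unitlM -(tens_mapM (counitM A) idM) mulVr //.
by rewrite -[X in tens_map _ _ X]pure1 tens_mapE tens_unitlE counit1 id_lfunE scale1r.
Qed.

(** The counterpart of [twist_elt_comul_sw] for the inverse of a twist: the
inverted cocycle identity, to which x (x) y (x) z |-> S(z) (x) x S(y) has been
applied. *)
Lemma twist_inv_comul_sw J : twist A J ->
  \sw_(u, v <- J^-1) ((1 *t u) * Delta (S v)) = (1 *t twist_elt_inv J) * sigma J.
Proof.
move=> hJ; have [uJ _ _ _] := hJ.
pose G (t : tens H (tens H H)) :=
  \sw_(x, r <- t) \sw_(y, z <- r) (S z *t (x * S y)).
have GA s z : G (tens_assoc H H H (s *t z)) = S z *t (\sw_(a, b <- s) (a * S b)).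
  move: s; apply: tens_ext; [rewrite /G; lin|lin|move=> x y].
  by rewrite tens_assocE /G !sw_pure //; lin.
have GL t : G (tens_assoc H H H ((J^-1 *t 1) * tens_map Delta \1%VF t)) =
    \sw_(u, v <- t) ((eps u : k) *: (S v *t twist_elt_inv J)).
  move: t; apply: tens_ext; [rewrite /G; lin|lin|move=> u v].
  rewrite tens_mapE id_lfunE pureM mul1r GA antipoder_comul_sw sw_pure; try lin.
  by rewrite pureZr.
have GP u r : G (u *t r) = (1 *t u) * sigma r.
  move: r; apply: tens_ext; [rewrite /G; lin|lin|move=> y z].
  by rewrite /G !sw_pure; try lin; rewrite antipode_flipE pureM mul1r.
have GR t : G ((1 *t J^-1) * tens_map \1%VF Delta t) =
    (\sw_(u, v <- t) ((1 *t u) * Delta (S v))) * sigma J^-1.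
  move: t; apply: tens_ext; [rewrite /G; lin|lin|move=> u v].
  rewrite tens_mapE id_lfunE pureM mul1r GP antipode_flipM -comul_antipode.
  by rewrite sw_pure ?mulrA //; lin.
rewrite -[LHS]mulr1 -(antipode_flip1 A) -(mulrV uJ) antipode_flipM mulrA -GR.
rewrite -twist_inv_cocycle // GL; congr (_ * _).
under eq_sw => u v do rewrite -pureZl -linearZ.
rewrite -(sw_map (F := fun z => S z *t twist_elt_inv J)); try lin.
by rewrite twist_inv_counitl_sw // antipode1.
Qed.

(** The Q_L in the coseparability form absorbs L^-1: this is the contribution of
L to the invariance of the form. *)
Lemma twist_inv_invariance_sw J : twist A J ->
  \sw_(u, v <- J^-1) (Delta (S (S v * twist_elt J)) * (S u *t 1)) =
  sigma J^-1 * (1 *t S (twist_elt J)).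
Proof.
move=> hJ; have [uJ _ _ _] := hJ.
transitivity
  (sigma ((\sw_(u, v <- J^-1) ((1 *t u) * Delta (S v))) * Delta (twist_elt J))).
  rewrite (sw_map (F := fun z => sigma (z * Delta (twist_elt J)))); try lin.
  apply: eq_sw => u v; rewrite comul_antipode -mulrA -comulM antipode_flipM.
  by rewrite antipode_flipE antipode1.
rewrite twist_inv_comul_sw // -mulrA comul_twist_elt // mulrA pureM twist_elt_invK //.
by rewrite antipode_flipM antipode_flipE antipode1 mul1r.
Qed.

End Twist.

(** * The integral on a unimodular cosemisimple Hopf algebra *)

(** Writes t as the sum of e_i (x) n_i over a basis (e_i).  If (id (x) g)(t)
vanishes then so does every g(n_i): this is how one concludes that t lies in
U (x) N when N is defined by the vanishing of functionals g. *)
Lemma tens_rows (k : fieldType) (U V : vectType k) (t : tens U V) :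
  exists2 n : 'I_(\dim {:U}) -> V,
    t = \sum_(i < \dim {:U}) (vbasis {:U})`_i *t n i &
    forall g : V -> k^o, islin g ->
      \sw_(a, b <- t) ((g b : k) *: a) = 0 -> forall i, g (n i) = 0.
Proof.
pose e (i : nat) := (vbasis {:U})`_i.
pose n i : V := \sum_(j < \dim {:V}) (t : 'M_(_, _)) i j *: (vbasis {:V})`_j.
have tE : t = \sum_(i < \dim {:U}) e i *t n i.
  rewrite [LHS]tens_basis; apply: eq_bigr => i _; rewrite /n.
  elim/big_ind2: _ => [|x x' y y' -> ->|j _]; last by rewrite pureZr.
    by rewrite -(scale0r (0 : V)) pureZr scale0r.
  by rewrite pureDr.
exists n => // g gl g0 i.
have : \sum_(i < \dim {:U}) (g (n i) : k) *: e i = 0.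
  rewrite -[RHS]g0 [in RHS]tE linear_sum; apply: eq_bigr => j _ /=.
  by rewrite sw_pure //; lin.
move/(freeP (basis_free (vbasisP {:U}))) => /(_ i).
by [].
Qed.

Section Integral.
Variables (k : fieldType) (H : falgType k) (A : hopf_algebra H).
Local Notation Delta := (comul A).
Local Notation eps := (counit A).
Local Notation S := (antipode A).

Definition dual_integral (lam : 'Hom(H, k^o)) :=
  forall x, \sw_(a, b <- Delta x) ((lam b : k) *: a) = (lam x : k) *: 1.

Variable lam : 'Hom(H, k^o).
Hypothesis lamI : dual_integral lam.
Hypothesis lam1 : lam 1 = 1.

(** S(x_1) lam(x_2 y) = y_1 lam(x y_2).  Both are
S(x_1) x_2 y_1 lam(x_3 y_2), in which either the first two factors cancel or
the last ones form lam applied to a coproduct. *)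
Lemma integral_sw x y :
  \sw_(a, b <- Delta x) ((lam (b * y) : k) *: S a) =
  \sw_(c, d <- Delta y) ((lam (x * d) : k) *: c).
Proof.
transitivity (\sw_(a, b <- Delta x) \sw_(a1, a2 <- Delta a)
    \sw_(c, d <- Delta y) ((lam (b * d) : k) *: (S a1 * a2 * c))); last first.
  under eq_sw => a b do rewrite exchange_sw.
  rewrite exchange_sw; apply: eq_sw => c d.
  under eq_sw => a b.
    rewrite (antipodel_sw A (f := fun z => (lam (b * d) : k) *: (z * c))); try lin.
    rewrite mul1r; over.
  by rewrite (counitl_sw A (f := fun z => (lam (z * d) : k) *: c)) //; lin.
rewrite (coassoc_sw A (f := fun a1 a2 b =>
  \sw_(c, d <- Delta y) ((lam (b * d) : k) *: (S a1 * a2 * c)))); try lin.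
apply: eq_sw => a b.
transitivity (S a * \sw_(c, d <- Delta (b * y)) ((lam d : k) *: c)).
  by rewrite lamI -scalerAr mulr1.
rewrite comulM mul_sw; try lin.
rewrite (sw_map (F := fun z => S a * z)); try lin; apply: eq_sw => c d.
rewrite (sw_map (F := fun z => S a * z)); try lin; apply: eq_sw => u v.
by rewrite -scalerAr mulrA.
Qed.

(** The right kernel N of (x, y) |-> lam(x y) satisfies Delta(N) <= H (x) N by
[integral_sw].  As N is a left ideal, eps(z) 1 = S(z_1) z_2 lies in N for z
in N, whence eps(z) = 0 since lam(1) = 1; so eps vanishes on N, and
y = y_1 eps(y_2) = 0 for y in N. *)
Lemma integral_rinj y : (forall x, lam (x * y) = 0) -> y = 0.
Proof.
move=> y0.
have cop z : (forall x, lam (x * z) = 0) ->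
    forall x, \sw_(c, d <- Delta z) ((lam (x * d) : k) *: c) = 0.
  move=> z0 x; rewrite -integral_sw -[RHS](linear0 (tens_lift (fun a b : H => a * b))).
  transitivity (\sw_(a, b <- Delta x) (0 : H)).
    by apply: eq_sw => a b; rewrite z0 scale0r.
  by rewrite linear0 /tens_lift big1 // => i _; rewrite big1 // => j _; rewrite scaler0.
have eps0 z : (forall x, lam (x * z) = 0) -> eps z = 0.
  move=> z0; have [n zE n0] := tens_rows (Delta z).
  have : \sw_(a, b <- Delta z) lam (S a * b) = eps z.
    by rewrite antipodel_sw; [rewrite lam1 /GRing.scale /= mulr1|lin].
  move=> <-; rewrite zE linear_sum big1 // => i _ /=; rewrite sw_pure; try lin.
  by apply: (n0 (fun b => lam (S (vbasis {:H})`_i * b))); [lin|exact: cop].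
have [n yE n0] := tens_rows (Delta y).
rewrite -(counitr_sw A (f := fun z => z) y (@islin_id _ _)) yE linear_sum.
rewrite big1 // => i _ /=; rewrite sw_pure; try lin.
rewrite eps0 ?scale0r // => x.
by apply: (n0 (fun b => lam (x * b))); [lin|exact: cop].
Qed.

Let e (i : nat) : H := (vbasis {:H})`_i.

(** The matrix of the form (x, y) |-> lam(x y) transfers its nondegeneracy from
the right to the left. *)
Definition gram : 'M[k]_(\dim {:H}) := \matrix_(i, j) (lam (e i * e j) : k).

Lemma gram_unit : gram \in unitmx.
Proof.
rewrite -unitmx_tr -row_free_unit; apply: inj_row_free => v vM.
pose y : H := \sum_(i < \dim {:H}) v 0 i *: e i.
have yE : y = 0.
  apply: integral_rinj => x; rewrite [x](coord_vbasis (memvf x)) mulr_suml linear_sum.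
  rewrite big1 // => i _; rewrite -scalerAl linearZ /=.
  suff -> : lam (e i * y) = 0 by rewrite scaler0.
  transitivity ((v *m gram^T) 0 i : k^o); last by rewrite vM mxE.
  rewrite mxE mulr_sumr linear_sum; apply: eq_bigr => j _ /=.
  by rewrite -scalerAr linearZ /= !mxE.
apply/rowP => i; rewrite mxE.
by have /(freeP (basis_free (vbasisP {:H})))/(_ i) := yE.
Qed.

Lemma gram_mull (v : 'rV[k]_(\dim {:H})) (j : 'I_(\dim {:H})) :
  lam ((\sum_(i < \dim {:H}) v 0 i *: e i) * e j) = (v *m gram) 0 j.
Proof.
rewrite mxE mulr_suml linear_sum; apply: eq_bigr => i _ /=.
by rewrite -scalerAl linearZ /= !mxE.
Qed.

Lemma integral_rep (f : H -> k^o) : islin f -> exists w, forall y, f y = lam (w * y).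
Proof.
move=> fl; pose r : 'rV[k]_(\dim {:H}) := \row_j (f (e j) : k).
exists (\sum_(i < \dim {:H}) (r *m invmx gram) 0 i *: e i) => y.
rewrite [y](coord_vbasis (memvf y)) mulr_sumr linear_sum.
have fS (h : 'I_(\dim {:H}) -> H) : f (\sum_i h i) = \sum_i f (h i).
  elim/big_rec2: _ => [|i x x' _ <-]; [exact: islin0|exact: islinD].
rewrite fS; apply: eq_bigr => j _; rewrite -scalerAr linearZ islinZ //=; congr (_ *: _).
by rewrite gram_mull mulmxKV ?gram_unit // mxE.
Qed.

Lemma integral_linj w : (forall y, lam (w * y) = 0) -> w = 0.
Proof.
move=> w0; pose v : 'rV[k]_(\dim {:H}) := \row_i coord (vbasis {:H}) i w.
have wE : w = \sum_(i < \dim {:H}) v 0 i *: e i.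
  by rewrite {1}(coord_vbasis (memvf w)); apply: eq_bigr => i _; rewrite mxE.
have vM : v *m gram = 0.
  by apply/rowP => j; rewrite -gram_mull -wE mxE w0.
rewrite wE big1 // => i _.
by rewrite -(mulmxK gram_unit v) vM mul0mx mxE scale0r.
Qed.

(** The t representing eps is a right integral, because t h - eps(h) t lies in
the left kernel of the form; unimodularity makes it a left integral. *)
Lemma unimodular_integral : unimodular A -> exists t,
  (forall y, lam (t * y) = eps y) /\ (forall y, lam (y * t) = eps y).
Proof.
move=> unim; have [|t tE] := @integral_rep eps; first by lin.
exists t; split=> // y.
have rt : right_integral A t.
  move=> h; apply/eqP; rewrite -subr_eq0; apply/eqP; apply: integral_linj => z.
  rewrite mulrBl linearB /= -scalerAl linearZ /= -mulrA -!tE counitM.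
  exact: subrr.
have -> : y * t = (eps y : k) *: t by apply: (proj2 (unim t)).
by rewrite linearZ /= -[t in LHS]mulr1 -tE counit1 [LHS]mulr1.
Qed.

Section Nakayama.
Variable t : H.
Hypothesis tl : forall y, lam (t * y) = eps y.
Hypothesis tr : forall y, lam (y * t) = eps y.

Lemma antipode_integral x :
  \sw_(a, b <- Delta t) ((lam (x * b) : k) *: a) = S x.
Proof.
rewrite -integral_sw.
under eq_sw => a b do rewrite tr.
by rewrite (counitr_sw A (f := fun z => S z)) //; lin.
Qed.

(** In particular S is onto, hence injective by finite dimension. *)
Lemma integral_antipode y :
  S (\sw_(a, b <- Delta t) ((lam (b * y) : k) *: a)) = y.
Proof.
rewrite (sw_map (F := S)); try lin.
under eq_sw => a b do rewrite linearZ.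
rewrite integral_sw.
under eq_sw => a b do rewrite tl.
by rewrite (counitr_sw A (f := fun z => z)) //; lin.
Qed.

Lemma antipode_inj_of_integral : injective S.
Proof.
apply/lker0P.
have full : limg S = fullv.
  apply/eqP; rewrite eqEsubv subvf /=; apply/subvP => y _.
  by rewrite -(integral_antipode y) memv_img ?memvf.
have := limg_ker_dim S fullv; rewrite full capfv -[RHS]add0n => /addIn.
by move/eqP; rewrite dimv_eq0.
Qed.

(** By [antipode_integral] and [integral_antipode] the functionals
f = lam(x -) and f = lam(- S^2(x)) give the same element t_1 f(t_2), namely
S(x), as S is injective.  Their difference is lam(w -) for some w, and then S(w) = 0 by
[antipode_integral] again. *)
Lemma nakayama_of_integral x y : lam (x * y) = lam (y * S (S x)).
Proof.
have [|w wE] := @integral_rep (fun y => lam (x * y) - lam (y * S (S x))).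
  by lin.
apply/eqP; rewrite -subr_eq0 wE.
suff -> : w = 0 by rewrite mul0r linear0.
apply: antipode_inj_of_integral; rewrite linear0 -antipode_integral.
under eq_sw => a b do rewrite -wE scalerBl.
transitivity (\sw_(a, b <- Delta t) ((lam (x * b) : k) *: a) -
  \sw_(a, b <- Delta t) ((lam (b * S (S x)) : k) *: a)).
  rewrite /tens_lift -sumrB; apply: eq_bigr => i _.
  by rewrite -sumrB; apply: eq_bigr => j _; rewrite scalerBr.
rewrite antipode_integral; apply/eqP; rewrite subr_eq0; apply/eqP.
by apply: antipode_inj_of_integral; rewrite integral_antipode.
Qed.

End Nakayama.

Lemma antipode_inj : unimodular A -> injective S.
Proof. by case/unimodular_integral => t [tl tr]; apply: antipode_inj_of_integral tl. Qed.

Lemma nakayama : unimodular A -> forall x y, lam (x * y) = lam (y * S (S x)).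
Proof.
by case/unimodular_integral => t [tl tr]; apply: nakayama_of_integral tl tr.
Qed.

End Integral.

(** * The coseparability form of the twisted coalgebra *)

(** In the dual algebra of C such a form is a separability idempotent. *)
Definition coseparability_form (k : fieldType) (C : vectType k) (A : coalgebra C)
    (B : 'Hom(tens C C, k^o)) : Prop :=
  (forall c, B (comul A c) = counit A c) /\
  (forall c d, \sw_(a, b <- comul A c) ((B (b *t d) : k) *: a) =
               \sw_(a, b <- comul A d) ((B (c *t a) : k) *: b)).

Section TwistedForm.
Variables (k : fieldType) (H : falgType k) (A : hopf_algebra H).
Local Notation Delta := (comul A).
Local Notation eps := (counit A).
Local Notation S := (antipode A).
Local Notation sigma := (antipode_flip A).

Lemma twist_conj_inv_sw J : twist A J ->
  \sw_(a, b <- J) (a * twist_elt_inv A J * S b) = 1.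
Proof.
case=> uJ _ _ _.
transitivity (\sw_(a, b <- J * J^-1) (a * S b)).
  rewrite mul_sw; try lin; apply: eq_sw => a b; rewrite /twist_elt_inv.
  rewrite (sw_map (F := fun z => a * z * S b)); try lin; apply: eq_sw => c d.
  by rewrite antipodeM !mulrA.
by rewrite mulrV // -pure1 sw_pure ?antipode1 ?mulr1 //; lin.
Qed.

Lemma twist_conj_sw J : twist A J ->
  \sw_(a, b <- J^-1) (S a * twist_elt A J * b) = 1.
Proof.
case=> uJ _ _ _.
transitivity (\sw_(a, b <- J * J^-1) (S a * b)).
  rewrite mul_sw; try lin; rewrite exchange_sw.
  apply: eq_sw => a b; rewrite /twist_elt.
  rewrite (sw_map (F := fun z => S a * z * b)); try lin; apply: eq_sw => c d.
  by rewrite antipodeM !mulrA.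
by rewrite mulrV // -pure1 sw_pure ?antipode1 ?mulr1 //; lin.
Qed.

Variable lam : 'Hom(H, k^o).
Hypothesis lamI : dual_integral A lam.
Hypothesis lam1 : lam 1 = 1.
Hypothesis unim : unimodular A.

(** When L = J, the map d |-> P_J S(d) Q_J is the antipode of the Hopf algebra
with comultiplication J^-1 Delta J and lam(- P_J S(Q_J)) is an integral on it;
the form is then lam(c S(d)) written for that Hopf algebra. *)
Definition twisted_form (L J : tens H H) : 'Hom(tens H H, k^o) :=
  linfun (fun t => \sw_(c, d <- t)
    lam (c * (twist_elt_inv A J * S d * S (twist_elt A L)))).

Lemma twisted_form_sw L J t : twisted_form L J t =
  \sw_(c, d <- t) lam (c * (twist_elt_inv A J * S d * S (twist_elt A L))).
Proof. by rewrite /twisted_form islin_linfun //; lin. Qed.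

Lemma twisted_formE L J c d : twisted_form L J (c *t d) =
  lam (c * (twist_elt_inv A J * S d * S (twist_elt A L))).
Proof. by rewrite twisted_form_sw sw_pure //; lin. Qed.

(** P_J cancels between the legs of J, then the antipode axiom removes h.  What
is left is lam(M^1 S(M^2) S(Q_L)) with M = L^-1, where [nakayama] moves the first leg
to the end, so that Q_L gets surrounded by the legs of L^-1. *)
Lemma twisted_form_comul L J h : twist A L -> twist A J ->
  twisted_form L J (L^-1 * Delta h * J) = eps h.
Proof.
move=> hL hJ; set Q := twist_elt A L; set a := twist_elt_inv A J.
transitivity (\sw_(x, y <- L^-1 * Delta h) lam (x * S y * S Q)).
  rewrite twisted_form_sw mul_sw; try lin; apply: eq_sw => x y.
  transitivity (\sw_(r, s <- J) lam (x * (r * a * S s) * S y * S Q)).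
    by apply: eq_sw => r s; rewrite antipodeM !mulrA.
  rewrite -(sw_map (F := fun z => lam (x * z * S y * S Q))); try lin.
  by rewrite twist_conj_inv_sw // mulr1.
rewrite -(sw_map (F := fun z => lam (z * S Q))); try lin.
rewrite antipoder_comul_sw -scalerAl linearZ /=.
suff -> : lam ((\sw_(a, b <- L^-1) (a * S b)) * S Q) = 1 by rewrite [LHS]mulr1.
rewrite (sw_map (F := fun z => lam (z * S Q))); try lin.
transitivity (\sw_(p, q <- L^-1) lam (S (S p * Q * q))).
  apply: eq_sw => p q; rewrite -mulrA (nakayama lamI lam1 unim).
  by rewrite !antipodeM !mulrA.
rewrite -(sw_map (F := fun z => lam (S z))); try lin.
by rewrite twist_conj_sw // antipode1.
Qed.

(** The identity is checked after applying the injective map S: then [nakayama]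
brings the leg q of L^-1 from the left of c_2 to the far right, and
[integral_sw] transfers the coproduct from c to s P_J S(d) S(Q_L) S^2(q),
where s is a leg of J. *)
Lemma twisted_form_invariant L J c d : twist A L -> twist A J ->
  \sw_(a, b <- L^-1 * Delta c * J) ((twisted_form L J (b *t d) : k) *: a) =
  \sw_(a, b <- L^-1 * Delta d * J) ((twisted_form L J (c *t a) : k) *: b).
Proof.
move=> hL hJ; set Q := twist_elt A L; set a := twist_elt_inv A J.
apply: (antipode_inj lamI lam1 unim).
pose G (t : tens H H) := \sw_(u, v <- t) ((lam (c * v) : k) *: u).
have Gmul x z t : S x * G t * S z = G ((S x *t 1) * t * (S z *t 1)).
  move: t; apply: tens_ext; [rewrite /G; lin|rewrite /G; lin|move=> u v].
  rewrite !pureM mul1r mulr1 /G !sw_pure; try lin.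
  by rewrite -scalerAr -scalerAl.
have Gflip t : G ((1 *t a) * sigma t * (1 *t S Q)) =
    S (\sw_(u, v <- t) ((twisted_form L J (c *t u) : k) *: v)).
  move: t; apply: tens_ext; [rewrite /G; lin|lin|move=> u v].
  rewrite antipode_flipE !pureM mul1r mulr1 /G !sw_pure; try lin.
  by rewrite twisted_formE linearZ.
rewrite -Gflip (sw_map (F := S)); try lin.
transitivity (\sw_(p, q <- L^-1) \sw_(r, s <- J)
   G (((S r *t 1) * Delta s * Delta a) * Delta (S d) *
      (Delta (S (S q * Q)) * (S p *t 1)))); last first.
  under eq_sw => p q.
    rewrite -(sw_map (F := fun z => G (z * Delta (S d) *
      (Delta (S (S q * Q)) * (S p *t 1))))); try (rewrite /G; lin).
    over.
  rewrite -(sw_map (F := fun z => G ((\sw_(r, s <- J)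
     ((S r *t 1) * Delta s * Delta a)) * Delta (S d) * z))); try (rewrite /G; lin).
  rewrite twist_invariance_sw // twist_inv_invariance_sw //.
  by rewrite comul_antipode !antipode_flipM !mulrA.
do 2 (rewrite mul_sw; try lin).
apply: eq_sw => p q; rewrite exchange_sw; apply: eq_sw => r s.
transitivity (S r * (\sw_(x, y <- Delta c)
   ((lam (y * (s * (a * S d * S Q) * S (S q))) : k) *: S x)) * S p).
  rewrite (sw_map (F := fun z => S r * z * S p)); try lin; apply: eq_sw => x y.
  rewrite twisted_formE linearZ /= -scalerAr -scalerAl !antipodeM mulrA.
  by rewrite -/a -/Q -!mulrA (nakayama lamI lam1 unim q) !mulrA.
rewrite (integral_sw lamI) -/(G _) Gmul; congr (G _).
by rewrite !antipodeM !comulM !mulrA.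
Qed.

Lemma twisted_coseparable L J (hL : twist A L) (hJ : twist A J) :
  coseparability_form (twisted_coalgebra hL hJ) (twisted_form L J).
Proof.
split=> [c|c d]; rewrite /= !twisted_comulE; first exact: twisted_form_comul.
exact: twisted_form_invariant.
Qed.

End TwistedForm.

(** * Coseparable coalgebras are cosemisimple *)

Section TensorSubspace.
Variable k : fieldType.
Implicit Types U V W : vectType k.

Lemma tensv_subP U V (D : {vspace U}) (E : {vspace V}) (X : {vspace tens U V}) :
  (forall u v, u \in D -> v \in E -> u *t v \in X) -> (tensv D E <= X)%VS.
Proof.
move=> h; apply/span_subvP => t /allpairsP [[u v] [/= uD vE ->]].
by apply: h; apply: vbasis_mem.
Qed.

Lemma eq_tensv U V W (D : {vspace U}) (E : {vspace V}) (F G : tens U V -> W) :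
  islin F -> islin G ->
  (forall u v, u \in D -> v \in E -> F (u *t v) = G (u *t v)) ->
  forall t, t \in tensv D E -> F t = G t.
Proof.
move=> Fl Gl FG t tDE.
have sub : (tensv D E <= lker (linfun F - linfun G))%VS.
  apply: tensv_subP => u v uD vE; rewrite memv_ker !lfunE /= opp_lfunE.
  by rewrite !islin_linfun // subr_eq0 FG.
have := subvP sub t tDE; rewrite memv_ker !lfunE /= opp_lfunE.
by rewrite !islin_linfun // subr_eq0 => /eqP.
Qed.

Lemma memv_sw U V W (X : {vspace W}) (f : U -> V -> W) t :
  (forall u v, f u v \in X) -> \sw_(a, b <- t) f a b \in X.
Proof. by move=> h; apply: memv_suml => i _; apply: memv_suml => j _; apply: memvZ. Qed.

Lemma memv_sw_tensv U V W (D : {vspace U}) (E : {vspace V}) (X : {vspace W})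
    (f : U -> V -> W) t :
  (forall y, islin (fun x => f x y)) -> (forall x, islin (f x)) ->
  (forall u v, u \in D -> v \in E -> f u v \in X) ->
  t \in tensv D E -> \sw_(a, b <- t) f a b \in X.
Proof.
move=> f1 f2 h tDE.
have <- : projv X (\sw_(a, b <- t) f a b) = \sw_(a, b <- t) f a b.
  move: t tDE; apply: eq_tensv; [lin|lin|move=> u v uD vE].
  by rewrite !sw_pure // projv_id // h.
exact: memv_proj.
Qed.

Lemma tens_map_sw U V (X Y : vectType k) (f : 'Hom(U, X)) (g : 'Hom(V, Y)) (t : tens U V) :
  tens_map f g t = \sw_(a, b <- t) (f a *t g b).
Proof.
move: t; apply: tens_ext; [lin|lin|move=> u v].
by rewrite tens_mapE sw_pure //; lin.
Qed.

End TensorSubspace.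

Section Coseparable.
Variables (k : fieldType) (C : vectType k) (A : coalgebra C).
Local Notation Delta := (comul A).
Local Notation eps := (counit A).
Variable B : 'Hom(tens C C, k^o).
Hypothesis copB : coseparability_form A B.

Lemma mem_comul (D : {vspace C}) c : subcoalgebra A D -> c \in D ->
  Delta c \in tensv D D.
Proof. by move=> /subvP sD cD; apply/sD/memv_img. Qed.

Section Projection.
Variable D : {vspace C}.
Hypothesis sD : subcoalgebra A D.
Local Notation p := (projv D).
(** In the dual algebra, 1 - eta and 1 - eta' are a right and a left unit of the
ideal orthogonal to D; hence eta and eta' are the same central idempotent, and
P and Q are its two actions on C. *)
Let eta c : k^o := \sw_(a, b <- Delta c) B (a *t p b).
Let eta' c : k^o := \sw_(a, b <- Delta c) B (p a *t b).
Let P c := \sw_(a, b <- Delta c) ((eta b : k) *: a).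
Let Q c := \sw_(a, b <- Delta c) ((eta' a : k) *: b).

Let eta_lin : islin eta. Proof. by rewrite /eta; lin. Qed.
Let eta'_lin : islin eta'. Proof. by rewrite /eta'; lin. Qed.
Let P_lin : islin P. Proof. by rewrite /P /eta; lin. Qed.
Let Q_lin : islin Q. Proof. by rewrite /Q /eta'; lin. Qed.

Let etaE c : c \in D -> eta c = eps c.
Proof.
move=> cD; have [nB _] := copB; rewrite -nB; move: (mem_comul sD cD).
apply: eq_tensv; [rewrite /eta; lin|lin|move=> u v uD vD].
by rewrite sw_pure ?projv_id //; lin.
Qed.

Let eta'E c : c \in D -> eta' c = eps c.
Proof.
move=> cD; have [nB _] := copB; rewrite -nB; move: (mem_comul sD cD).
apply: eq_tensv; [rewrite /eta; lin|lin|move=> u v uD vD].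
by rewrite sw_pure ?projv_id //; lin.
Qed.

Let P_mem c : P c \in D.
Proof.
have [_ iB] := copB.
have -> : P c = \sw_(a, b <- Delta c) \sw_(x, y <- Delta (p b)) ((B (a *t x) : k) *: y).
  transitivity (\sw_(a, b <- Delta c) \sw_(b1, b2 <- Delta b)
     ((B (b1 *t p b2) : k) *: a)).
    apply: eq_sw => a b; rewrite /eta.
    by rewrite (sw_map (F := fun z : k^o => (z : k) *: a)) //; lin.
  rewrite -(coassoc_sw A (f := fun a b1 b2 => (B (b1 *t p b2) : k) *: a)); try lin.
  by apply: eq_sw => a b; rewrite iB.
apply: memv_sw => a b.
apply: (memv_sw_tensv (D := D) (E := D)); try lin; last exact/mem_comul/memv_proj.
by move=> u v _ vD; apply: memvZ.
Qed.

Let Q_mem c : Q c \in D.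
Proof.
have [_ iB] := copB.
have -> : Q c = \sw_(a, b <- Delta c) \sw_(x, y <- Delta (p a)) ((B (y *t b) : k) *: x).
  transitivity (\sw_(a, b <- Delta c) \sw_(a1, a2 <- Delta a)
     ((B (p a1 *t a2) : k) *: b)).
    apply: eq_sw => a b; rewrite /eta'.
    by rewrite (sw_map (F := fun z : k^o => (z : k) *: b)) //; lin.
  rewrite (coassoc_sw A (f := fun a1 a2 b => (B (p a1 *t a2) : k) *: b)); try lin.
  by apply: eq_sw => a b; rewrite iB.
apply: memv_sw => a b.
apply: (memv_sw_tensv (D := D) (E := D)); try lin; last exact/mem_comul/memv_proj.
by move=> u v uD _; apply: memvZ.
Qed.

Let P_id c : c \in D -> P c = c.
Proof.
move=> cD; rewrite -[RHS](counitr_sw A (f := fun z => z) c (@islin_id _ _)).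
move: (mem_comul sD cD); apply: eq_tensv; [lin|lin|move=> u v uD vD].
rewrite !sw_pure ?etaE //; lin.
Qed.

Let Q_id c : c \in D -> Q c = c.
Proof.
move=> cD; rewrite -[RHS](counitl_sw A (f := fun z => z) c (@islin_id _ _)).
move: (mem_comul sD cD); apply: eq_tensv; [lin|lin|move=> u v uD vD].
rewrite !sw_pure ?eta'E //; lin.
Qed.

(** P and Q commute and are both projections onto D. *)
Let PQ c : P c = Q c.
Proof.
rewrite -[LHS](Q_id (P_mem c)) -[RHS](P_id (Q_mem c)).
transitivity (\sw_(a, b <- Delta c) \sw_(a1, a2 <- Delta a)
   ((eta b : k) *: ((eta' a1 : k) *: a2))).
  rewrite {1}/P (sw_map (F := Q)) //; apply: eq_sw => a b.
  by rewrite islinZ // /Q (sw_map (F := fun z => (eta b : k) *: z)) //; lin.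
rewrite (coassoc_sw A (f := fun a1 a2 b => (eta b : k) *: ((eta' a1 : k) *: a2))); try lin.
rewrite [in RHS]/Q (sw_map (F := P)) //; apply: eq_sw => a b.
rewrite islinZ // /P (sw_map (F := fun z => (eta' a : k) *: z)); try lin.
by apply: eq_sw => b1 b2; rewrite !scalerA mulrC.
Qed.

Let P_comull c : Delta (P c) = \sw_(a, b <- Delta c) (a *t P b).
Proof.
transitivity (\sw_(a, b <- Delta c) \sw_(a1, a2 <- Delta a) ((eta b : k) *: (a1 *t a2))).
  rewrite {1}/P (sw_map (F := Delta)); try lin; apply: eq_sw => a b.
  rewrite linearZ /= -[Delta a in LHS]sw_id.
  by rewrite (sw_map (F := fun z => (eta b : k) *: z)) //; lin.
rewrite (coassoc_sw A (f := fun a1 a2 b => (eta b : k) *: (a1 *t a2))); try lin.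
apply: eq_sw => a b; rewrite /P (sw_map (F := fun z => a *t z)); try lin.
by apply: eq_sw => b1 b2; rewrite pureZr.
Qed.

Let P_comulr c : Delta (P c) = \sw_(a, b <- Delta c) (P a *t b).
Proof.
rewrite PQ; transitivity (\sw_(a, b <- Delta c) \sw_(b1, b2 <- Delta b)
   ((eta' a : k) *: (b1 *t b2))).
  rewrite {1}/Q (sw_map (F := Delta)); try lin; apply: eq_sw => a b.
  rewrite linearZ /= -[Delta b in LHS]sw_id.
  by rewrite (sw_map (F := fun z => (eta' a : k) *: z)) //; lin.
rewrite -(coassoc_sw A (f := fun a b1 b2 => (eta' a : k) *: (b1 *t b2))); try lin.
apply: eq_sw => a b; rewrite PQ /Q (sw_map (F := fun z => z *t b)); try lin.
by apply: eq_sw => b1 b2; rewrite pureZl.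
Qed.

Lemma subcoalgebra_projection : exists P : 'End(C),
  [/\ forall c, P c \in D, forall c, c \in D -> P c = c,
      forall c, Delta (P c) = tens_map P \1%VF (Delta c)
    & forall c, Delta (P c) = tens_map \1%VF P (Delta c)].
Proof.
have PE c : linfun P c = P c by rewrite islin_linfun.
exists (linfun P); split=> [c|c cD|c|c].
- by rewrite PE.
- by rewrite PE P_id.
- by rewrite PE P_comulr tens_map_sw; apply: eq_sw => a b; rewrite PE id_lfunE.
- by rewrite PE P_comull tens_map_sw; apply: eq_sw => a b; rewrite PE id_lfunE.
Qed.

End Projection.

(** The complement is the image of D0 under R = 1 - P.  Since R is an idempotent
that is colinear on both sides, Delta(R(c)) = (R (x) R)(Delta(c)). *)
Lemma subcoalgebra_complement (D D0 : {vspace C}) :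
  subcoalgebra A D -> subcoalgebra A D0 -> (D <= D0)%VS ->
  exists E : {vspace C}, [/\ subcoalgebra A E, (D + E)%VS = D0 & (D :&: E)%VS = 0%VS].
Proof.
move=> sD sD0 DD0; have [P [PD Pid Pl Pr]] := subcoalgebra_projection sD.
pose R := (\1 - P)%VF; have RE c : R c = c - P c by rewrite !lfunE /= opp_lfunE id_lfunE.
have PR c : P (R c) = 0 by rewrite RE linearB /= (Pid _ (PD c)) subrr.
have RR c : R (R c) = R c by rewrite {1}RE PR subr0.
have Rl c : Delta (R c) = tens_map R \1%VF (Delta c).
  rewrite RE linearB /= Pl; move: (Delta c); apply: tens_ext; [lin|lin|move=> u v].
  by rewrite !tens_mapE !id_lfunE RE pureDl -scaleN1r -pureZl scaleN1r.
have Rr c : Delta (R c) = tens_map \1%VF R (Delta c).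
  rewrite RE linearB /= Pr; move: (Delta c); apply: tens_ext; [lin|lin|move=> u v].
  by rewrite !tens_mapE !id_lfunE RE pureDr -scaleN1r -pureZr scaleN1r.
have Rlr c : Delta (R c) = \sw_(a, b <- Delta c) (R a *t R b).
  rewrite -RR Rl Rr; move: (Delta c); apply: tens_ext; [lin|lin|move=> u v].
  by rewrite !tens_mapE !id_lfunE sw_pure //; lin.
exists (R @: D0)%VS; split.
- apply/subvP => _ /memv_imgP [_ /memv_imgP [c cD0 ->] ->]; rewrite Rlr.
  apply: (memv_sw_tensv (D := D0) (E := D0)); try lin; last exact: mem_comul.
  by move=> u v uD vD; apply: memv_tensv; apply: memv_img.
- apply/eqP; rewrite eqEsubv subv_add DD0 /=; apply/andP; split.
    apply/subvP => _ /memv_imgP [c cD0 ->]; rewrite RE.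
    by apply: memvB => //; apply: (subvP DD0).
  apply/subvP => c cD0; have -> : c = P c + R c by rewrite RE addrC subrK.
  by apply: memv_add => //; apply: memv_img.
- apply/eqP; rewrite -subv0; apply/subvP => c; rewrite memv_cap => /andP [cD].
  by case/memv_imgP => d _ cE; rewrite memv0 -(Pid c cD) cE PR.
Qed.

Lemma directv_split m n (V : 'I_m -> {vspace C}) (W : 'I_n -> {vspace C}) :
  directv (\sum_i V i) -> directv (\sum_i W i) ->
  (\sum_i V i :&: \sum_i W i)%VS = 0%VS ->
  let F i := match split i with inl j => V j | inr j => W j end in
  directv (\sum_i F i) /\ (\sum_i F i = \sum_i V i + \sum_i W i)%VS.
Proof.
move=> dV dW VW F.
have Fl j : F (lshift n j) = V j by rewrite /F (unsplitK (inl j)).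
have Fr j : F (rshift m j) = W j by rewrite /F (unsplitK (inr j)).
have FE : (\sum_i F i = \sum_i V i + \sum_i W i)%VS.
  rewrite big_split_ord /=; congr (_ + _)%VS; apply: eq_bigr => j _; [exact: Fl|exact: Fr].
split=> //; rewrite directvE /= FE dimv_disjoint_sum // big_split_ord /=.
move: dV dW; rewrite !directvE /= => /eqP -> /eqP ->.
by apply/eqP; congr (_ + _)%N; apply: eq_bigr => j _; rewrite ?Fl ?Fr.
Qed.

Lemma subcoalgebra_sum_simple (D : {vspace C}) : subcoalgebra A D ->
  exists (n : nat) (F : 'I_n -> {vspace C}),
    [/\ forall i, simple_subcoalgebra A (F i),
        directv (\sum_i F i) & (\sum_i F i)%VS = D].
Proof.
have [m] := ubnP (\dim D); elim: m D => // m IH D Dm sD.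
case: (eqVneq D 0%VS) => [->|D0].
  exists 0, (fun=> 0%VS); split=> [[]//||]; last by rewrite big_ord0.
  by rewrite directvE /= !big_ord0 dimv0.
case: (classic (simple_subcoalgebra A D)) => [simD|nsimD].
  exists 1, (fun=> D); split=> //; last by rewrite big_ord1.
  by rewrite directvE /= !big_ord1.
have [E [sE ED E0 EnD]] : exists E,
    [/\ subcoalgebra A E, (E <= D)%VS, E != 0%VS & E != D].
  apply: NNPP => nE; apply: nsimD; split=> // E sE ED.
  case: (eqVneq E 0%VS) => [|E0]; [by left|right].
  by apply/eqP/negP => /negP EnD; apply: nE; exists E.
have [E' [sE' DE EE']] := subcoalgebra_complement sE sD ED.
have dE : (\dim D = \dim E + \dim E')%N by rewrite -DE dimv_disjoint_sum.
have E0' : (0 < \dim E)%N by rewrite lt0n dimv_eq0.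
have E'0 : (0 < \dim E')%N.
  rewrite lt0n dimv_eq0; apply: contra EnD => /eqP E'0.
  by rewrite -DE E'0 addv0.
have [||n1 [F1 [s1 d1 e1]]] := IH E; [by rewrite dE in Dm; lia| by []|].
have [||n2 [F2 [s2 d2 e2]]] := IH E'; [by rewrite dE in Dm; lia| by []|].
have [|dF eF] := directv_split d1 d2; first by rewrite e1 e2.
exists (n1 + n2)%N, (fun i => match split i with inl j => F1 j | inr j => F2 j end).
split; [|exact: dF|by rewrite eF e1 e2].
by move=> i; case: (split i) => j; [exact: s1|exact: s2].
Qed.

Lemma coseparable_cosemisimple : cosemisimple A.
Proof.
apply: subcoalgebra_sum_simple; apply/subvP => t _; rewrite -[t]sw_id.
by apply: memv_sw => a b; apply: memv_tensv; apply: memvf.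
Qed.

End Coseparable.

(** As Delta(1) = 1 (x) 1 and the simple summands are subcoalgebras, 1 cannot
have nonzero components in two of them; the summand which contains 1 is then
spanned by 1, and lam is the component along it. *)
Lemma cosemisimple_integral (k : fieldType) (H : falgType k) (A : hopf_algebra H) :
  cosemisimple A -> exists2 lam, dual_integral A lam & lam 1 = 1.
Proof.
case=> n [D [simD dirD fullD]].
pose pi i := sumv_pi_for (esym fullD) i.
have pi_mem i x : pi i x \in D i by exact: memv_sum_pi.
have pi_sum x : x = \sum_i pi i x by rewrite sumv_pi_sum ?memvf.
have pi_id i j x : x \in D i -> pi j x = if j == i then x else 0.
  move=> xD; apply/eqP; move: j; apply/forallP.
  rewrite -(directv_sum_unique dirD) // => [|j _]; last first.
    by case: eqP => [->|_]; rewrite ?mem0v.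
  by rewrite -pi_sum -big_mkcond big_pred1_eq.
have pi_orth i j x : i != j -> tens_map (pi i) (pi j) (comul A x) = 0.
  move=> ij; rewrite [x]pi_sum !linear_sum big1 // => l _ /=.
  have [_ sD _] := simD l.
  move: (mem_comul sD (pi_mem l x)).
  apply: (eq_tensv (G := fun=> 0)) => [||u v uD vD]; first by lin.
    by move=> a s t; rewrite scaler0 addr0.
  rewrite tens_mapE !(pi_id l) //; case: (eqVneq i l) => [il|_]; last by rewrite pure0l.
  by rewrite -il eq_sym (negPf ij) -(scale0r (0 : H)) pureZr scale0r.
have [i0 i0P] : exists i, pi i 1 != 0.
  apply/existsP; rewrite -negb_forall; apply/negP => /forallP h.
  have /eqP := pi_sum (1 : H); rewrite big1 ?(negPf (oner_neq0 _)) // => i _.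
  exact/eqP/h.
have other j : j != i0 -> pi j 1 = 0.
  move=> ji; apply/eqP; apply: contraT => jP.
  have := pi_orth j i0 1 ji; rewrite comul1 -pure1 tens_mapE => /eqP.
  by rewrite (negPf (pure_neq0 jP i0P)).
have one_mem : 1 \in D i0.
  suff -> : (1 : H) = pi i0 1 by [].
  by rewrite [LHS]pi_sum (bigD1 i0) //= big1 ?addr0.
have D1 : D i0 = <[1]>%VS.
  have [_ _ minD] := simD i0.
  have s1 : subcoalgebra A <[1]>%VS.
    apply/subvP => _ /memv_imgP [_ /vlineP [c ->] ->].
    by rewrite linearZ /= comul1 -pure1 memvZ // memv_tensv // memv_line.
  have [|/eqP|->] // := minD <[1]>%VS s1.
  by rewrite -dimv_eq0 dim_vline oner_neq0.
pose lam : 'Hom(H, k^o) := (counit A \o pi i0)%VF.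
have lamE x : lam x = counit A (pi i0 x) by rewrite comp_lfunE.
exists lam; last by rewrite lamE (pi_id i0) // eqxx counit1.
move=> x; rewrite [x]pi_sum.
rewrite !linear_sum scaler_suml; apply: eq_bigr => l _ /=.
case: (eqVneq l i0) => [->|li0].
  have := pi_mem i0 x; rewrite D1 => /vlineP [c ->].
  rewrite !linearZ /= comul1 -pure1 sw_pure; try lin.
  by rewrite scalerA.
have lam0 y : y \in D l -> lam y = 0.
  by move=> yD; rewrite lamE (pi_id l) // eq_sym (negPf li0) linear0.
have [_ sD _] := simD l; rewrite lam0 // scale0r.
move: (mem_comul sD (pi_mem l x)); apply: (eq_tensv (G := fun=> 0)) => [||u v uD vD].
- by lin.
- by move=> a s t; rewrite scaler0 addr0.
- by rewrite sw_pure; try lin; rewrite lam0 // scale0r.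
Qed.

Theorem theorem3p13 (k : closedFieldType) (H : falgType k)
    (A : hopf_algebra H) (L J : tens H H)
    (hL : twist A L) (hJ : twist A J) :
  cosemisimple A -> unimodular A -> cosemisimple (twisted_coalgebra hL hJ).
Proof.
move=> /cosemisimple_integral [lam lamI lam1] unim.
exact: coseparable_cosemisimple (twisted_coseparable lamI lam1 unim hL hJ).
Qed.
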